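(* Let $k\geq 1$ and let $d_1,\ldots,d_k\geq 2$ be integers, and put $D=d_1+\cdots+d_k$. Then there exist positive rational numbers $\alpha_0,\ldots,\alpha_k$ and $\beta_0,\ldots,\beta_k$ such that the following holds. Let $L$ be the least common multiple of the denominators of all $\alpha_i,\beta_i$; for a positive integer $r$ that is a perfect $L$-th power put $r_i=r^{\alpha_i}$, $m_i=r^{\beta_i}$ (positive integers), define $$P_0(t)=r^{\beta_0+3\alpha_0}t^3+r^{2\alpha_0}t^2-r^{\alpha_0+\beta_0}t+1,\qquad P_i(t)=r^{\beta_i+d_i\alpha_i}t^{d_i}+\sum_{\ell=0}^{d_i-1}r^{\ell\alpha_i}t^{\ell}\ (1\leq i\leq k),$$ $P(t)=\left(\prod_{i=1}^kP_i(t)\right)P_0(t)$, and the integral polytope $\mathcal{P}=\left(\prod_{i=1}^k r_i\mathcal{S}_{d_i}(m_i)\right)\times r_0\mathcal{T}_{m_0}$ of dimension $D+3$. Then $P(t)$ is a polynomial of degree $D+3$ in $t$, and for all sufficiently large such $r$, $$\operatorname{Sgn}(\mathcal{P})=(-1,\underbrace{+1,-1,\ldots,-1}_{d_1},\underbrace{+1,-1,\ldots,-1}_{d_2},\ldots,\underbrace{+1,-1,\ldots,-1}_{d_k});$$ in other words, the coefficients in $P(t)$ of $t^{D+3}$, $t^{D+2}$, $t^{d_j+d_{j+1}+\cdots+d_k}$ for $1\leq j\leq k$, and the constant term are positive, while the remaining coefficients are negative.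
   Context: For a positive integer $m$, the Reeve tetrahedron $\mathcal{T}_m\subset\mathbb{R}^3$ is the convex hull of $(0,0,0),(1,0,0),(0,1,0),(1,1,m)$. For positive integers $d,m$, $\mathcal{S}_1(m)=[0,m]\subset\mathbb{R}$ and, for $d\geq2$, $\mathcal{S}_d(m)=\mathrm{conv}\{\mathbf{0},\mathbf{e}_1,\ldots,\mathbf{e}_{d-1},(q_1(d),\ldots,q_{d-1}(d),d!\cdot m)\}\subset\mathbb{R}^d$ with $\mathbf{e}_i$ the unit coordinate vectors and $q_i(d)=-d!/(i!+(i-1)!)$. For a polytope $\mathcal{Q}$ and positive integer $r$, $r\mathcal{Q}=\{r\alpha:\alpha\in\mathcal{Q}\}$; $\times$ is the Cartesian product of polytopes. For a $d$-dimensional integral polytope $\mathcal{Q}$ with Ehrhart polynomial $i(\mathcal{Q},t)=\#(t\mathcal{Q}\cap\mathbb{Z}^d)=1+\sum_{i=1}^d c_it^i$, its sign vector is $\operatorname{Sgn}(\mathcal{Q})=(\operatorname{sgn}(c_{d-2}),\ldots,\operatorname{sgn}(c_1))$, where $\operatorname{sgn}$ is the sign function with values $-1,0,+1$. *)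

(* Defs.v *)
From HB Require Import structures.
From mathcomp Require Import all_boot all_order all_algebra.
From mathcomp Require Import boolp classical_sets functions cardinality.
From mathcomp Require Import reals exp.

Set Implicit Arguments.
Unset Strict Implicit.
Unset Printing Implicit Defensive.

Import Order.TTheory GRing.Theory Num.Theory.

Local Open Scope classical_set_scope.
Local Open Scope ring_scope.

Section Polytopes.
Variable R : realType.

Definition conv (n : nat) (A : set 'rV[R]_n) : set 'rV[R]_n :=
  [set x | exists (N : nat) (w : 'I_N -> R) (v : 'I_N -> 'rV[R]_n),
     [/\ forall i, 0 <= w i, \sum_i w i = 1, forall i, A (v i)
       & x = \sum_i w i *: v i]].

Definition dilate (n : nat) (c : R) (Q : set 'rV[R]_n) : set 'rV[R]_n :=
  [set c *: x | x in Q].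

Definition prod2 (n1 n2 : nat) (A : set 'rV[R]_n1) (B : set 'rV[R]_n2) :
    set 'rV[R]_(n1 + n2) :=
  [set x | A (lsubmx x) /\ B (rsubmx x)].

Definition prodn (k : nat) (d : 'I_k -> nat) (Q : forall i, set 'rV[R]_(d i)) :
    set 'rV[R]_(\sum_i d i)%N :=
  [set x | forall i, Q i (submxrow x i)].

Definition vec3 (a b c : R) : 'rV[R]_3 := \row_i [:: a; b; c]`_i.

Definition reeve (m : R) : set 'rV[R]_3 :=
  conv [set vec3 0 0 0; vec3 1 0 0; vec3 0 1 0; vec3 1 1 m].

Definition qcoef (d i : nat) : R := - (d`!%:R / (i`! + i.-1`!)%:R).

(* Coordinates are indexed from 0, so entry j holds q_(j+1)(d). *)
Definition apex (d : nat) (m : R) : 'rV[R]_d :=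
  \row_j (if j == d.-1 :> nat then d`!%:R * m else qcoef d j.+1).

(* For d = 1 this is conv {0, m}, the interval [0, m]. *)
Definition Ssimplex (d : nat) (m : R) : set 'rV[R]_d :=
  conv ([set 0] `|` [set delta_mx 0 i | i in [set i : 'I_d | (i < d.-1)%N]]
        `|` [set apex d m]).

Definition intpt (n : nat) (z : 'rV[int]_n) : 'rV[R]_n := map_mx intr z.

Definition integral_polytope (n : nat) (Q : set 'rV[R]_n) : Prop :=
  exists V : set 'rV[int]_n, finite_set V /\ Q = conv [set intpt z | z in V].

(* Dimension of the affine hull: e is the largest number of linearly
   independent differences of points of Q with a common base point. *)
Definition has_dim (n : nat) (Q : set 'rV[R]_n) (e : nat) : Prop :=
  (exists x0 (M : 'M[R]_(e, n)),
     [/\ Q x0, forall i, Q (x0 + row i M) & row_free M]) /\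
  (forall f x0 (M : 'M[R]_(f, n)),
     Q x0 -> (forall i, Q (x0 + row i M)) -> row_free M -> (f <= e)%N).

Definition is_ehrhart (n : nat) (Q : set 'rV[R]_n) (p : {poly R}) : Prop :=
  forall t : nat, (0 < t)%N -> exists N : nat,
    ([set z : 'rV[int]_n | dilate t%:R Q (intpt z)] #= `I_N)%card
    /\ p.[t%:R] = N%:R.

(* A polynomial is determined by its values at the positive integers, so there
   is at most one p with is_ehrhart Q p; the value is 0 when there is none. *)
Definition ehrhart (n : nat) (Q : set 'rV[R]_n) : {poly R} :=
  xget 0 [set p | is_ehrhart Q p].

(* (sgn c_(n-2), ..., sgn c_1), for Q of full dimension n *)
Definition Sgn (n : nat) (Q : set 'rV[R]_n) : seq int :=
  [seq sgz (ehrhart Q)`_i | i <- rev (iota 1 (n - 2))].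

Definition ratpow (r : nat) (a : rat) : R := r%:R `^ ratr a.

Definition factor0 (r : nat) (a b : rat) : {poly R} :=
  ratpow r (b + 3 * a) *: 'X^3 + ratpow r (2 * a) *: 'X^2
  - ratpow r (a + b) *: 'X + 1.

Definition factori (r d : nat) (a b : rat) : {poly R} :=
  ratpow r (b + d%:R * a) *: 'X^d + \sum_(l < d) ratpow r (l%:R * a) *: 'X^l.

(* Index 0 of alpha, beta goes with the Reeve factor; the factor of dimension
   d i, i : 'I_k, has index lift ord0 i (that is, i + 1). *)
Definition prod_poly (k : nat) (d : 'I_k -> nat) (alpha beta : 'I_k.+1 -> rat)
    (r : nat) : {poly R} :=
  (\prod_(i < k) factori r (d i) (alpha (lift ord0 i)) (beta (lift ord0 i)))
  * factor0 r (alpha ord0) (beta ord0).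

Definition prod_polytope (k : nat) (d : 'I_k -> nat)
    (alpha beta : 'I_k.+1 -> rat) (r : nat) : set 'rV[R]_(\sum_i d i + 3)%N :=
  prod2
    (prodn (fun i : 'I_k =>
       dilate (ratpow r (alpha (lift ord0 i)))
         (Ssimplex (d := d i) (ratpow r (beta (lift ord0 i))))))
    (dilate (ratpow r (alpha ord0)) (reeve (ratpow r (beta ord0)))).

End Polytopes.

Arguments prod_polytope R {k} d alpha beta r _.

Definition lcm_denoms (k : nat) (alpha beta : 'I_k.+1 -> rat) : nat :=
  \big[lcmn/1%N]_(i < k.+1) lcmn `|denq (alpha i)|%N `|denq (beta i)|%N.

Definition perfect_power (L r : nat) : Prop := exists s : nat, r = (s ^ L)%N.

Definition positive_integer (R : realType) (x : R) : Prop :=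
  exists2 N : nat, (0 < N)%N & x = N%:R.

Definition sign_pattern (k : nat) (d : 'I_k -> nat) : seq int :=
  -1 :: flatten [seq 1 :: nseq (d i).-1 (-1) | i <- enum 'I_k].

Definition positive_exponent (k : nat) (d : 'I_k -> nat) (n : nat) : bool :=
  let D := (\sum_i d i)%N in
  [|| n == (D + 3)%N, n == (D + 2)%N, n == 0%N
    | [exists j : 'I_k, n == (\sum_(i < k | j <= i) d i)%N]].

(* Main.v *)
Require Import Defs.
From HB Require Import structures.
From mathcomp Require Import all_boot all_order all_algebra.
From mathcomp Require Import boolp classical_sets functions cardinality.
From mathcomp Require Import reals exp.
From mathcomp Require Import zify ring lra.

(** The Ehrhart polynomial of [S_d(m)] is [(t + 1)^d + (m - 1) t^d]: slicing by
    the last coordinate [Z = u m + s], the lattice points over [Z] are counted by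
    a binomial coefficient that depends only on whether [s = 0] and on the number
    of ascents of the digits of [u] in the factorial number system, so that the
    sum over [u] is Worpitzky's identity.  The same slicing gives
    [m/6 t^3 + t^2 + (2 - m/6) t + 1] for the Reeve tetrahedron.  Hence the
    Ehrhart polynomial of the product and the polynomial [P] have the same
    exponents of [r] and the same signs, monomial by monomial, up to bounded
    positive factors, and one sign analysis settles both.

    A term of the coefficient of [t^n] is a choice of degrees [l_1, ..., l_k] and
    [l_0] with sum [n]; it is negative iff [l_0 = 1].  Take
    [alpha_0 = 1/2], [beta_0 = 1/2 + e], [alpha_i = 1 - 3^-i],
    [beta_i = 3^-i + 2 e] with [e = 3^-k / 4].  Relative to [r^n], each unit of
    degree in factor [i] costs [3^-i], except the last one, which gains [2 e],
    whereas the single unit [l_0 = 1] gains [e].  So the leading term fills the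
    factors completely in the order [k, k-1, ...] and has [l_0 = 0] exactly when
    nothing is left over, that is, when [n = d_j + ... + d_k]. *)

Set Implicit Arguments.
Unset Strict Implicit.
Unset Printing Implicit Defensive.

Import Order.TTheory GRing.Theory Num.Theory.

(** * Heights in the factorial number system *)

Lemma sum_nat_mul (a b : nat) (F : nat -> nat) :
  (\sum_(0 <= u < a * b) F u =
   \sum_(0 <= i < a) \sum_(0 <= j < b) F (i * b + j))%N.
Proof.
elim: a => [|a IH]; first by rewrite mul0n !big_geq.
rewrite big_nat_recr //= -IH mulSn addnC (@big_cat_nat _ _ _ (a * b)) //=; last by lia.
congr addn; rewrite -{1}[(a * b)%N]add0n big_addn.
have -> : (a * b + b - a * b)%N = b by lia.
by apply: eq_bigr => j _; rewrite addnC.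
Qed.

(** With coordinates counted from 0, this is the denominator of $-q_{j+1}(d)=d!/((j+1)!+j!)$. Floors
    of quotients by it bound the coordinates of lattice points in a slice of the simplex. *)
Definition fden (j : nat) : nat := (j.+1`! + j`!)%N.

Lemma fdenE j : fden j = (j`! * j.+2)%N.
Proof. by rewrite /fden factS; lia. Qed.

Lemma fden_gt0 j : (0 < fden j)%N.
Proof. by rewrite /fden addn_gt0 fact_gt0. Qed.

Lemma fden_dvd_fact j n : (j < n)%N -> fden j %| n.+1`!.
Proof.
elim: n => [//|n IH]; rewrite ltnS leq_eqVlt => /predU1P[->|jn].
  by rewrite fdenE !factS; apply/dvdnP; exists n.+1; nia.
by rewrite factS dvdn_mull // IH.
Qed.

(** Telescoping: 1/(j!(j+2)) = 1/(j+1)! - 1/(j+2)!. Hence the $q_i(n+1)$ minus one add up to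
    -(n+1)!, which makes the bound on the coordinate sum of a slice a plain division by m. *)
Lemma sum_fact_div_fden n : (\sum_(j < n) n.+1`! %/ fden j + 1 = n.+1`!)%N.
Proof.
elim: n => [|n IH]; first by rewrite big_ord0.
rewrite big_ord_recr /=.
have -> : (n.+2`! %/ fden n = n.+1)%N.
  have -> : n.+2`! = (n.+1 * fden n)%N by rewrite fdenE !factS; nia.
  by rewrite mulnK // fden_gt0.
under eq_bigr => j _.
  rewrite factS -muln_divA; last by apply: fden_dvd_fact.
  over.
rewrite -big_distrr /=.
by rewrite (factS n.+1) -[in RHS]IH mulnDr muln1 -addnA addn1.
Qed.

Definition divsum (n u : nat) : nat := \sum_(j < n) u %/ fden j.

Lemma divsum_le n u : (divsum n u <= u)%N.
Proof.
rewrite -(leq_pmul2r (fact_gt0 n.+1)) big_distrl /=.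
apply: (@leq_trans (\sum_(j < n) u * (n.+1`! %/ fden j))).
  apply: leq_sum => j _.
  have /dvdnP [q Eq] := fden_dvd_fact (ltn_ord j).
  rewrite Eq mulnK ?fden_gt0 // mulnCA mulnC leq_mul2r leq_trunc_div.
  by rewrite orbT.
rewrite -big_distrr leq_mul2l; apply/orP; right.
by rewrite -[leqRHS]sum_fact_div_fden leq_addr.
Qed.

(** The truncated subtraction is exact by [divsum_le]. Over last coordinate Z = u m the lattice
    points of the t-th dilate form a unit simplex of size t minus this height. *)
Definition height (n u : nat) : nat := (u - divsum n u)%N.

Lemma heightE n u : (height n u + divsum n u = u)%N.
Proof. by rewrite subnK // divsum_le. Qed.

(** Every [fden j] divides (n+1)!, so adding a (n+1)! shifts each floor exactly; by
    [sum_fact_div_fden] the shifts total a ((n+1)! - 1), one a short of the shift of u itself. *)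
Lemma height_shift n a v : height n (a * n.+1`! + v) = (a + height n v)%N.
Proof.
have D : divsum n (a * n.+1`! + v) = (a * (n.+1`! - 1) + divsum n v)%N.
  rewrite /divsum -[in RHS](sum_fact_div_fden n) addnK big_distrr /= -big_split /=.
  apply: eq_bigr => j _.
  have /dvdnP [q Eq] := fden_dvd_fact (ltn_ord j).
  by rewrite Eq mulnK ?fden_gt0 // mulnA divnMDl ?fden_gt0.
have := heightE n (a * n.+1`! + v); have := heightE n v.
rewrite D; move: (fact_gt0 n.+1) (height n _) (height n _) (divsum n v); move: (n.+1`!) => F; nia.
Qed.

(* With u = k * n.+1`! + v in the factorial number system, k is the new leading
   digit and v %/ n`! the previous one: height counts the ascents of the digits. *)
Lemma height_rec n k v : (k <= n.+1)%N -> (v < n.+1`!)%N ->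
  height n.+1 (k * n.+1`! + v) = (height n v + (v %/ n`! < k))%N.
Proof.
move=> kn vn.
set u := (k * n.+1`! + v)%N.
have D : divsum n.+1 u = (divsum n u + u %/ fden n)%N.
  by rewrite /divsum big_ord_recr.
have jn : (v %/ n`! <= n)%N.
  by rewrite -ltnS ltn_divLR ?fact_gt0 // -factS.
(* With j the previous digit, u divided by n! is k (n+1) + j = k (n+2) + (j - k). Dividing by n+2
   leaves k, or k - 1 when j < k. *)
have Q : (u %/ fden n + (v %/ n`! < k) = k)%N.
  rewrite fdenE divnMA /u factS mulnA divnMDl ?fact_gt0 //.
  move: jn; set j := (v %/ n`!)%N => jn.
  case: (ltnP j k) => jk.
    have -> : (k * n.+1 + j = k.-1 * n.+2 + (n.+2 + j - k))%N by nia.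
    rewrite divnMDl // divn_small; lia.
  have -> : (k * n.+1 + j = k * n.+2 + (j - k))%N by nia.
  rewrite divnMDl // divn_small; lia.
have := heightE n.+1 u; have := heightE n u; rewrite D.
rewrite {1 3}/u height_shift; lia.
Qed.

Lemma height_le n v : (v < n.+1`!)%N -> (height n v <= n)%N.
Proof.
elim: n v => [|n IH] v vn.
  by move: vn; rewrite /height; case: v.
rewrite (divn_eq v n.+1`!) height_rec.
- have := IH _ (ltn_pmod v (fact_gt0 n.+1)).
  by case: ltnP => /= _; lia.
- by rewrite -ltnS ltn_divLR ?fact_gt0 // -factS.
- by rewrite ltn_pmod // fact_gt0.
Qed.

(** Each term is the difference of x^j (x+1)^(n+1-j) between j and j+1, because (x+1) - x = 1; the
    boundary terms are placed so that no subtraction occurs. *)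
Lemma sum_pow_telescope x n a b : (a <= b <= n.+1)%N ->
  (\sum_(a <= j < b) x ^ j * x.+1 ^ (n - j) + x ^ b * x.+1 ^ (n.+1 - b)
   = x ^ a * x.+1 ^ (n.+1 - a))%N.
Proof.
move=> /andP[ab]; elim: b ab => [|b IH] ab bn.
  by rewrite big_geq //; move: ab; rewrite leqn0 => /eqP->.
case: (ltnP b a) => ba.
  have -> : a = b.+1 by lia.
  by rewrite big_geq.
rewrite big_nat_recr //= -IH //; last by lia.
rewrite -addnA; congr addn.
have -> : (n.+1 - b = (n - b).+1)%N by lia.
rewrite subSS !expnS; nia.
Qed.

(** Worpitzky's identity refined by the leading digit k. The refinement carries the induction on n,
    since by [height_rec] a new digit only needs to be compared with the previous one. *)
Lemma sum_height_digit n k t : (k <= n)%N ->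
  (\sum_(0 <= w < n`!) 'C(t + n - height n (k * n`! + w), n)
   = t ^ k * t.+1 ^ (n - k))%N.
Proof.
elim: n k t => [|n IH] k t kn.
  have -> : k = 0 by lia.
  by rewrite big_nat1 bin0.
have step s : (\sum_(0 <= w < n.+1`!) 'C(s + n.+1 - height n.+1 (k * n.+1`! + w), n.+1)
  = \sum_(0 <= j < n.+1) \sum_(0 <= w < n`!)
      'C(s + n.+1 - (height n (j * n`! + w) + (j < k)), n.+1))%N.
  rewrite {1}factS sum_nat_mul; apply: eq_big_nat => j /andP[_ jn].
  apply: eq_big_nat => w /andP[_ wn].
  rewrite height_rec //; last by rewrite factS; nia.
  by rewrite divnMDl ?fact_gt0 // divn_small // addn0.
rewrite step.
have hb j w : (j < n.+1)%N -> (w < n`!)%N -> (height n (j * n`! + w) <= n)%N.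
  by move=> jn wn; apply: height_le; rewrite factS; nia.
elim: t => [|t IHt].
  (* At t = 0 a digit j < k makes the binomial vanish. For j >= k the binomial tests whether the
     height is 0, and so does the one in the induction hypothesis. *)
  transitivity (\sum_(0 <= j < n.+1) if (j < k)%N then 0 else 0 ^ j)%N.
    apply: eq_big_nat => j /andP[_ jn]; case: ifP => jk.
      rewrite big_nat_cond big1 // => w /andP[/andP[_ wn] _].
      by rewrite bin_small //; lia.
    have := IH j 0 jn; rewrite exp1n muln1 => <-.
    apply: eq_big_nat => w /andP[_ wn].
    rewrite addn0 !add0n; have := hb j w jn wn.
    case: (height n _) => [|g] gn; first by rewrite !subn0 !binn.
    by rewrite !bin_small //; lia.
  rewrite exp1n muln1 big_nat_recl // big_nat_cond big1 ?addn0; last first.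
    by move=> j _; rewrite exp0n //; case: ifP.
  by case: posnP => [->|k0] //; rewrite exp0n.
(* Pascal's rule: the first part is the case t, and the second is known from the induction on n, at
   t for the digits j < k and at t+1 for the others. Both ranges of digits then telescope. *)
transitivity (\sum_(0 <= j < n.+1) (\sum_(0 <= w < n`!)
      'C(t + n.+1 - (height n (j * n`! + w) + (j < k)), n.+1)
   + (if (j < k)%N then t ^ j * t.+1 ^ (n - j) else t.+1 ^ j * t.+2 ^ (n - j))))%N.
  apply: eq_big_nat => j /andP[_ jn].
  have -> : (if (j < k)%N then t ^ j * t.+1 ^ (n - j) else t.+1 ^ j * t.+2 ^ (n - j))%N
    = (\sum_(0 <= w < n`!) 'C(t + n.+1 - (height n (j * n`! + w) + (j < k)), n))%N.
    case: ifP => jk; rewrite -IH //; apply: eq_big_nat => w /andP[_ wn];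
      by congr binomial; have := hb j w jn wn; lia.
  rewrite -big_split /=; apply: eq_big_nat => w /andP[_ wn].
  have -> : (t.+1 + n.+1 - (height n (j * n`! + w) + (j < k))
    = (t + n.+1 - (height n (j * n`! + w) + (j < k))).+1)%N.
    by have := hb j w jn wn; case: (j < k)%N; lia.
  by rewrite binS.
rewrite big_split /= IHt (@big_cat_nat _ _ _ k) //=.
rewrite (@eq_big_nat _ _ _ 0 k _ (fun j => t ^ j * t.+1 ^ (n - j))%N); last first.
  by move=> j /andP[_ ->].
rewrite (@eq_big_nat _ _ _ k n.+1 _ (fun j => t.+1 ^ j * t.+2 ^ (n - j))%N); last first.
  by move=> j /andP[kj _]; rewrite ltnNge kj.
have := @sum_pow_telescope t n 0 k; rewrite leq0n kn => /(_ isT).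
have := @sum_pow_telescope t.+1 n k n.+1; rewrite kn leqnn => /(_ isT).
rewrite subnn !expn0 subn0 muln1 mul1n; lia.
Qed.

(** The block of u with quotient a by (n+1)! is the first block with t replaced by t - a, and it
    contributes (t-a+1)^(n+1) - (t-a)^(n+1), which telescopes. Blocks with a > t vanish, so any
    cut-off T > t gives the same sum. *)
Lemma worpitzky_height n t T : (0 < n)%N -> (t < T)%N ->
  (\sum_(0 <= u < T * n.+1`!) 'C(t + n - height n u, n) = t.+1 ^ n.+1)%N.
Proof.
move=> n0; rewrite sum_nat_mul.
have first_block s :
    (\sum_(0 <= v < n.+1`!) 'C(s + n - height n v, n) + s ^ n.+1 = s.+1 ^ n.+1)%N.
  rewrite factS sum_nat_mul.
  rewrite (@eq_big_nat _ _ _ 0 n.+1 _ (fun j => s ^ j * s.+1 ^ (n - j))%N); last first.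
    by move=> j /andP[_ jn]; apply: sum_height_digit.
  have := @sum_pow_telescope s n 0 n.+1; rewrite leqnn => /(_ isT).
  by rewrite subnn !expn0 subn0 muln1 mul1n.
elim: t T => [|t IH] [|T] //= tT; rewrite big_nat_recl //=.
  under eq_big_nat do rewrite mul0n add0n.
  have := first_block 0; rewrite exp0n // addn0 => ->.
  rewrite big_nat_cond big1 ?addn0 // => a _.
  rewrite big_nat_cond big1 // => v _.
  by rewrite height_shift bin_small //; lia.
under eq_big_nat do rewrite mul0n add0n.
rewrite -(first_block t.+1); congr addn.
rewrite -(IH T) //; apply: eq_big_nat => a _; apply: eq_big_nat => v _.
by rewrite !height_shift; congr binomial; lia.
Qed.

Local Open Scope ring_scope.

(** * Convex hulls and products *)

Section Listed.
Local Open Scope classical_set_scope.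
Local Open Scope ring_scope.

(** Explicit enumerations keep counting elementary: products and slices become operations on
    sequences, and cardinals enter only through [listed_card_eq]. *)
Definition listed (T : eqType) (A : set T) (N : nat) : Prop :=
  exists s : seq T, [/\ uniq s, size s = N & forall x, A x <-> x \in s].

Lemma listed_card_eq (T : choiceType) (A : set T) N : listed A N -> (A #= `I_N)%card.
Proof.
move=> [s [us <- As]].
have -> : A = [set` s] by apply/seteqP; split=> x /As.
apply/card_set_bijP; exists (index^~ s); split=> [x /=|x y|i /= ilt].
- by rewrite index_mem.
- by rewrite !inE /= => xs ys; apply: index_inj.
- case: s us {As} ilt => // x0 s us ilt.
  by exists (nth x0 (x0 :: s) i); [exact: mem_nth|exact: index_uniq].
Qed.

End Listed.

Lemma dep_choice (I : Type) (T : I -> Type) (P : forall i, T i -> Prop) :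
  (forall i, exists x, P i x) -> exists f : forall i, T i, forall i, P i (f i).
Proof.
move=> H; exists (fun i => sval (cid (H i))) => i.
exact: svalP (cid (H i)).
Qed.

Section Convexity.
Local Open Scope classical_set_scope.
Local Open Scope ring_scope.
Variable R : realType.

Definition convex_set n (C : set 'rV[R]_n) : Prop :=
  forall N (w : 'I_N -> R) (v : 'I_N -> 'rV[R]_n),
    (forall i, 0 <= w i) -> \sum_i w i = 1 -> (forall i, C (v i)) ->
    C (\sum_i w i *: v i).

Lemma conv_subset n (A C : set 'rV[R]_n) :
  convex_set C -> A `<=` C -> conv A `<=` C.
Proof.
move=> cC AC x [N [w [v [w0 w1 Av ->]]]].
by apply: cC => // i; apply: AC.
Qed.

(** Allowing any finite index type lets pairs and dependent pairs index the convex combinations that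
    arise from products and from nested hulls. *)
Lemma conv_fin n (A : set 'rV[R]_n) (I : finType) (w : I -> R) (v : I -> 'rV[R]_n) :
  (forall i, 0 <= w i) -> \sum_i w i = 1 -> (forall i, A (v i)) ->
  conv A (\sum_i w i *: v i).
Proof.
move=> w0 w1 Av; exists #|I|, (w \o enum_val), (v \o enum_val); split=> //=.
- by rewrite -[RHS]w1 -(big_enum_val w); apply: eq_bigl.
- by rewrite -(big_enum_val (fun i => w i *: v i)); apply: eq_bigl.
Qed.

Lemma sub_conv n (A : set 'rV[R]_n) : A `<=` conv A.
Proof.
move=> x Ax; have := @conv_fin n A 'I_1 (fun=> 1) (fun=> x).
by rewrite !big_ord1 scale1r; apply.
Qed.

Lemma convex_conv n (A : set 'rV[R]_n) : convex_set (conv A).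
Proof.
move=> N w v w0 w1 /dep_choice[M /dep_choice[u /dep_choice[a Ha]]].
have -> : \sum_i w i *: v i =
    \sum_(p : {i : 'I_N & 'I_(M i)}) (w (tag p) * u _ (tagged p)) *: a _ (tagged p).
  rewrite [RHS](esym (sig_big_dep xpredT (fun=> xpredT) (fun i (j : 'I_(M i)) => (w i * u i j) *: a i j))) /=.
  apply: eq_bigr => i _; have [_ _ _ ->] := Ha i.
  by rewrite scaler_sumr; apply: eq_bigr => j _; rewrite scalerA.
apply: conv_fin => [p||p].
- by have [u0 _ _ _] := Ha (tag p); rewrite mulr_ge0.
- rewrite [LHS](esym (sig_big_dep xpredT (fun=> xpredT) (fun i (j : 'I_(M i)) => w i * u i j))) /= -[RHS]w1.
  apply: eq_bigr => i _; have [_ u1 _ _] := Ha i.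
  by rewrite -mulr_sumr u1 mulr1.
- by have [_ _ Aa _] := Ha (tag p).
Qed.

Lemma convS n (A B : set 'rV[R]_n) : A `<=` B -> conv A `<=` conv B.
Proof.
by move=> AB; apply: conv_subset; [exact: convex_conv|move=> x /AB /sub_conv].
Qed.

Lemma convex_dilate n c (C : set 'rV[R]_n) : convex_set C -> convex_set (dilate c C).
Proof.
move=> cC N w v w0 w1 Cv.
have /dep_choice[u Hu] : forall i, exists u, C u /\ c *: u = v i.
  by move=> i; have [y Cy <-] := Cv i; exists y.
exists (\sum_i w i *: u i); first by apply: cC => // i; have [] := Hu i.
rewrite scaler_sumr; apply: eq_bigr => i _; have [_ <-] := Hu i.
by rewrite !scalerA mulrC.
Qed.

Lemma dilate_dilate n (a b : R) (Q : set 'rV[R]_n) :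
  dilate a (dilate b Q) = dilate (a * b) Q.
Proof.
apply/seteqP; split=> [x [_ [y Qy <-] <-]|x [y Qy <-]].
  by exists y => //; rewrite scalerA.
by exists (b *: y); [exists y|rewrite scalerA].
Qed.

Lemma dilate_conv n c (A : set 'rV[R]_n) : dilate c (conv A) `<=` conv (dilate c A).
Proof.
move=> x [_ [N [w [v [w0 w1 Av ->]]]] <-].
rewrite scaler_sumr.
rewrite (eq_bigr (fun i => w i *: (c *: v i))); last first.
  by move=> i _; rewrite !scalerA mulrC.
by apply: conv_fin => // i; exists (v i).
Qed.

Lemma scalemxE m n (c : R) (M : 'M[R]_(m, n)) i j : (c *: M) i j = c * M i j.
Proof. by rewrite mxE. Qed.

Section Products.
Variables (n1 n2 : nat).

Lemma convex_prod2 (A : set 'rV[R]_n1) (B : set 'rV[R]_n2) :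
  convex_set A -> convex_set B -> convex_set (prod2 A B).
Proof.
move=> cA cB N w v w0 w1 ABv; split.
  rewrite linear_sum /= (eq_bigr (fun i => w i *: lsubmx (v i))); last first.
    by move=> i _; rewrite linearZ.
  by apply: cA => // i; have [] := ABv i.
rewrite linear_sum /= (eq_bigr (fun i => w i *: rsubmx (v i))); last first.
  by move=> i _; rewrite linearZ.
by apply: cB => // i; have [] := ABv i.
Qed.

(** Take all pairs of points with the products of their weights; each projection collapses because
    the other family of weights sums to 1. *)
Lemma prod2_conv (A : set 'rV[R]_n1) (B : set 'rV[R]_n2) :
  prod2 (conv A) (conv B) `<=` conv (prod2 A B).
Proof.
move=> x [[N [w [v [w0 w1 Av xl]]]] [M [u [b [u0 u1 Bb xr]]]]].
have -> : x = \sum_(p : 'I_N * 'I_M) (w p.1 * u p.2) *: row_mx (v p.1) (b p.2).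
  rewrite -(pair_bigA _ (fun i j => (w i * u j) *: row_mx (v i) (b j))) /=.
  rewrite -[LHS]hsubmxK xl xr.
  apply/rowP=> j; rewrite summxE; case: (split_ordP j) => l ->.
    rewrite row_mxEl summxE; apply: eq_bigr => i _.
    rewrite summxE -[LHS]mulr1 -u1 mulr_sumr; apply: eq_bigr => i' _.
    by rewrite !scalemxE row_mxEl; ring.
  rewrite row_mxEr -[LHS]mul1r -w1 mulr_suml; apply: eq_bigr => i _.
  rewrite summxE summxE mulr_sumr; apply: eq_bigr => i' _.
  by rewrite !scalemxE row_mxEr; ring.
apply: conv_fin => [p||p]; first by rewrite mulr_ge0.
  rewrite -(pair_bigA _ (fun i j => w i * u j)) /= -[RHS]w1.
  by apply: eq_bigr => i _; rewrite -mulr_sumr u1 mulr1.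
by split; rewrite ?row_mxKl ?row_mxKr.
Qed.

Lemma dilate_prod2 c (A : set 'rV[R]_n1) (B : set 'rV[R]_n2) :
  dilate c (prod2 A B) = prod2 (dilate c A) (dilate c B).
Proof.
apply/seteqP; split=> [x [y [Ay By] <-]|x [[a Aa xl] [b Bb xr]]].
  by split; [exists (lsubmx y)|exists (rsubmx y)] => //; rewrite linearZ.
exists (row_mx a b); first by split; rewrite ?row_mxKl ?row_mxKr.
by rewrite scale_row_mx xl xr hsubmxK.
Qed.

End Products.

Section BlockProducts.
Variables (k : nat) (d : 'I_k -> nat).

Lemma submxrowZ m (c : R) (x : 'M[R]_(m, \sum_i d i)) i :
  submxrow (c *: x) i = c *: submxrow x i.
Proof. by apply/matrixP => a b; rewrite !mxE. Qed.

Lemma convex_prodn (Q : forall i, set 'rV[R]_(d i)) :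
  (forall i, convex_set (Q i)) -> convex_set (prodn Q).
Proof.
move=> cQ N w v w0 w1 Qv i; rewrite submxrow_sum.
rewrite (eq_bigr (fun j => w j *: submxrow (v j) i)); last first.
  by move=> j _; rewrite submxrowZ.
by apply: cQ => // j; apply: Qv.
Qed.

Lemma prodn_conv (V : forall i, set 'rV[R]_(d i)) :
  prodn (fun i => conv (V i)) `<=` conv (prodn V).
Proof.
(* Induction on the number j of blocks that are allowed to lie in the hull
   only: the block j is split along its convex combination. *)
suff H j x : (forall i : 'I_k, (i < j)%N -> conv (V i) (submxrow x i)) ->
    (forall i : 'I_k, (j <= i)%N -> V i (submxrow x i)) -> conv (prodn V) x.
  by move=> x Vx; apply: (H k) => // i; rewrite leqNgt ltn_ord.
elim: j x => [|j IH] x Hlt Hge; first by apply: sub_conv => i; apply: Hge.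
case: (ltnP j k) => jk; last first.
  by apply: IH => i ij; [apply: Hlt; lia|have := ltn_ord i; lia].
pose i0 := Ordinal jk.
have [N [w [v [w0 w1 Vv xj]]]] := Hlt i0 (ltnSn j).
pose X l := \mxrow_i (dfwith (fun i => submxrow x i) (v l) i).
have -> : x = \sum_l w l *: X l.
  rewrite -[LHS]submxrowK; apply/mxrowP => i; rewrite submxrow_sum mxrowK.
  rewrite [RHS](eq_bigr (fun l => w l *: dfwith (fun i => submxrow x i) (v l) i));
    last by move=> l _; rewrite submxrowZ mxrowK.
  have [->|ii] := eqVneq i i0.
    by rewrite xj; apply: eq_bigr => l _; rewrite dfwith_in.
  rewrite [RHS](eq_bigr (fun l => w l *: submxrow x i)); last first.
    by move=> l _; rewrite dfwith_out // eq_sym.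
  by rewrite -scaler_suml w1 scale1r.
apply: convex_conv => // l; apply: IH => i ij; rewrite mxrowK.
  rewrite dfwith_out; last by apply/eqP => ii; move: ij; rewrite -ii ltnn.
  by apply: Hlt; lia.
have [->|ii] := eqVneq i i0; first by rewrite dfwith_in.
rewrite dfwith_out 1?eq_sym //; apply: Hge.
by rewrite ltn_neqAle ij andbT; apply: contra ii => /eqP E; apply/eqP/val_inj.
Qed.

Lemma dilate_prodn c (Q : forall i, set 'rV[R]_(d i)) :
  dilate c (prodn Q) = prodn (fun i => dilate c (Q i)).
Proof.
apply/seteqP; split=> [x [y Qy <-] i|x Qx].
  by exists (submxrow y i) => //; rewrite submxrowZ.
have /dep_choice[y Hy] : forall i, exists y, Q i y /\ c *: y = submxrow x i.
  by move=> i; have [y Qy <-] := Qx i; exists y.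
exists (\mxrow_i y i); first by move=> i; rewrite mxrowK; have [] := Hy i.
rewrite -[RHS]submxrowK; apply/mxrowP => i; rewrite submxrowZ !mxrowK.
by have [] := Hy i.
Qed.

End BlockProducts.
End Convexity.

(** * Lattice points of products *)

Section Factors.
Local Open Scope classical_set_scope.
Local Open Scope ring_scope.
Variable R : realType.

Definition lattice_points n (Q : set 'rV[R]_n) : set 'rV[int]_n :=
  [set z | Q (intpt R z)].

(** An invariant stable under dilation and products that yields integrality, dimension and Ehrhart
    polynomial at once. The origin serves as base point for the dimension and as filler for the
    remaining blocks when a basis of a product is assembled. *)
Record ehrhart_factor n (Q : set 'rV[R]_n) (p : {poly R}) : Prop := EhrhartFactor {
  factor_convex : convex_set Q;
  factor_hull : Q `<=` conv [set intpt R z | z in lattice_points Q];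
  factor_zero : Q 0;
  factor_basis : exists2 M : 'M[R]_n, M \in unitmx & forall i, Q (row i M);
  factor_count : forall t : nat, (0 < t)%N ->
    exists2 N, listed (lattice_points (dilate t%:R Q)) N & p.[t%:R] = N%:R }.

Lemma poly_eq_on_nat (p q : {poly R}) :
  (forall t : nat, (0 < t)%N -> p.[t%:R] = q.[t%:R]) -> p = q.
Proof.
move=> pq; apply/eqP; rewrite -subr_eq0; apply/negPn/negP => nz.
pose s := [seq t.+1%:R | t <- iota 0 (size (p - q))] : seq R.
have := @max_poly_roots _ (p - q) s nz.
rewrite size_map size_iota ltnn => H; suff: false by [].
apply: H.
- apply/allP => _ /mapP[t _ ->]; rewrite rootE hornerD hornerN pq ?subrr //.
- rewrite map_inj_uniq ?iota_uniq // => a b /eqP.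
  by rewrite eqr_nat => /eqP[].
Qed.

Lemma is_ehrhart_eq n (Q : set 'rV[R]_n) p : is_ehrhart Q p -> ehrhart Q = p.
Proof.
move=> Qp; apply: xget_unique => // q Qq; apply: poly_eq_on_nat => t t0.
have [N [cN ->]] := Qq t t0; have [M [cM ->]] := Qp t t0.
by congr (_%:R); apply/card_eq_II; rewrite -(card_eql cN).
Qed.

Lemma factor_ehrhart n (Q : set 'rV[R]_n) p : ehrhart_factor Q p -> ehrhart Q = p.
Proof.
move=> F; apply: is_ehrhart_eq => t t0.
have [N lN pN] := factor_count F t0.
by exists N; split=> //; apply: listed_card_eq.
Qed.

Lemma dilate1 n (Q : set 'rV[R]_n) : dilate 1 Q = Q.
Proof.
apply/seteqP; split=> [x [y Qy <-]|x Qx]; first by rewrite scale1r.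
by exists x => //; rewrite scale1r.
Qed.

Lemma factor_integral n (Q : set 'rV[R]_n) p :
  ehrhart_factor Q p -> integral_polytope Q.
Proof.
(* All lattice points serve as generators, so no vertex set has to be identified; the count at t = 1
   shows that they are finitely many. *)
move=> F; exists (lattice_points Q); split.
  have [N lN _] := factor_count F (ltn0Sn 0).
  by apply/finite_setP; exists N; apply: listed_card_eq; rewrite dilate1 in lN.
apply/seteqP; split; first exact: factor_hull F.
by apply: conv_subset; [exact: factor_convex F|move=> _ [z Qz <-]].
Qed.

Lemma factor_dim n (Q : set 'rV[R]_n) p : ehrhart_factor Q p -> has_dim Q n.
Proof.
move=> F; have [M uM QM] := factor_basis F; split.
  exists 0, M; split; first exact: factor_zero F.
    by move=> i; rewrite add0r.
  by rewrite row_free_unit.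
by move=> f x0 N _ _ /eqP <-; apply: rank_leq_col.
Qed.

Section Prod2.
Variables (n1 n2 : nat).

Lemma listed_prod2 (A : set 'rV[int]_n1) (B : set 'rV[int]_n2) N M :
  listed A N -> listed B M ->
  listed [set z : 'rV[int]_(n1 + n2) | A (lsubmx z) /\ B (rsubmx z)] (N * M).
Proof.
move=> [s [us <- As]] [s' [us' <- Bs']].
exists [seq row_mx x y | x <- s, y <- s']; split.
- by apply: allpairs_uniq => // -[a b] [a' b'] _ _ /= /eq_row_mx[-> ->].
- by rewrite size_allpairs.
- move=> z; split=> [[/As zs /Bs' zs']|/allpairsP[[a b] /= [/As ? /Bs' ? ->]]].
    by apply/allpairsP; exists (lsubmx z, rsubmx z); split=> //=; rewrite hsubmxK.
  by split; rewrite ?row_mxKl ?row_mxKr.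
Qed.

Lemma lattice_points_prod2 (A : set 'rV[R]_n1) (B : set 'rV[R]_n2) :
  lattice_points (prod2 A B) =
  [set z | lattice_points A (lsubmx z) /\ lattice_points B (rsubmx z)].
Proof.
by apply/seteqP; split=> z; rewrite /lattice_points /prod2 /= /intpt map_lsubmx map_rsubmx.
Qed.

Lemma factor_prod2 (A : set 'rV[R]_n1) (B : set 'rV[R]_n2) p q :
  ehrhart_factor A p -> ehrhart_factor B q -> ehrhart_factor (prod2 A B) (p * q).
Proof.
move=> FA FB; split.
- by apply: convex_prod2; [exact: factor_convex FA|exact: factor_convex FB].
- move=> x [/(factor_hull FA) xl /(factor_hull FB) xr].
  apply: convS (prod2_conv (conj xl xr)) => y [[a Aa ya] [b Bb yb]].
  exists (row_mx a b); last by rewrite /intpt map_row_mx -!/(intpt _ _) ya yb hsubmxK.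
  by rewrite lattice_points_prod2 /=; split; rewrite ?row_mxKl ?row_mxKr.
- by split; rewrite linear0; [exact: factor_zero FA|exact: factor_zero FB].
- have [M uM AM] := factor_basis FA; have [L uL BL] := factor_basis FB.
  exists (block_mx M 0 0 L).
    by rewrite unitmxE det_ublock unitrM -!unitmxE uM uL.
  move=> i; case: (split_ordP i) => j ->; rewrite /block_mx ?rowKu ?rowKd row_row_mx row0.
    by split; rewrite ?row_mxKl ?row_mxKr //; exact: factor_zero FB.
  by split; rewrite ?row_mxKl ?row_mxKr //; exact: factor_zero FA.
- move=> t t0; have [N lN pN] := factor_count FA t0.
  have [M lM qM] := factor_count FB t0; exists (N * M)%N.
    by rewrite dilate_prod2 lattice_points_prod2; apply: listed_prod2.
  by rewrite hornerM pN qM natrM.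
Qed.
End Prod2.

Section Prodn.
Variables (k : nat) (d : 'I_k -> nat).

Lemma listed_prodn (A : forall i, set 'rV[int]_(d i)) (N : 'I_k -> nat) :
  (forall i, listed (A i) (N i)) ->
  listed [set z : 'rV[int]_(\sum_i d i) | forall i, A i (submxrow z i)]
    (\prod_i N i).
Proof.
move=> /dep_choice[s Hs].
(* A lattice point is encoded by the positions of its blocks in the lists [s i]; such dependent
   functions are enumerable and their number is the product. *)
pose v (f : {dffun forall i, 'I_(N i)}) : 'rV[int]_(\sum_i d i) :=
  \mxrow_i nth 0 (s i) (f i).
exists [seq v f | f <- enum {dffun forall i, 'I_(N i)}]; split.
- rewrite map_inj_uniq ?enum_uniq // => f g fg.
  apply/ffunP => i; apply/val_inj/eqP; have [us sz _] := Hs i.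
  rewrite -(nth_uniq 0 _ _ us) ?sz ?ltn_ord //.
  by rewrite -[X in X == _](mxrowK (fun i => nth 0 (s i) (f i))) -/(v f) fg mxrowK.
- rewrite size_map -cardE card_dep_ffun foldrE big_map big_enum /=.
  by apply: eq_bigr => i _; rewrite card_ord.
- move=> z; split=> [Az|/mapP[f _ ->] i]; last first.
    by rewrite mxrowK; have [_ sz ->] := Hs i; rewrite mem_nth // sz.
  have H i : (index (submxrow z i) (s i) < N i)%N.
    by have [_ <- /(_ (submxrow z i))[H _]] := Hs i; rewrite index_mem H //; exact: Az.
  apply/mapP; exists [ffun i => Ordinal (H i)]; first by rewrite mem_enum.
  rewrite -[LHS]submxrowK; apply/mxrowP => i; rewrite !mxrowK ffunE /= nth_index //.
  by have [_ _ <-] := Hs i; exact: Az.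
Qed.

Lemma lattice_points_prodn (A : forall i, set 'rV[R]_(d i)) :
  lattice_points (prodn A) =
  [set z | forall i, lattice_points (A i) (submxrow z i)].
Proof.
have E z i : intpt R (submxrow z i) = submxrow (intpt R z) i.
  by apply/rowP => j; rewrite !mxE.
by apply/seteqP; split=> z /= H i; have := H i; rewrite /lattice_points /= E.
Qed.

(** Needed for the rows of a block-diagonal matrix: cut into blocks, such a row consists of zeros
    and of rows of the diagonal blocks. *)
Lemma submxrow_delta i j : (submxrow (delta_mx 0 i : 'rV[R]_(\sum_i d i)) j = 0) \/
  exists l, submxrow (delta_mx 0 i : 'rV[R]_(\sum_i d i)) j = delta_mx 0 l.
Proof.
have [[l li]|no] := pselect (exists l, tagnat.Rank j l = i).
  right; exists l; apply/rowP => m; rewrite !mxE /= -li; congr (_%:R).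
  by rewrite -val_eqE tagnat.eq_Rank eqxx val_eqE.
left; apply/rowP => m; rewrite !mxE /=; case: eqP => //= E.
by case: no; exists m.
Qed.

Lemma factor_prodn (A : forall i, set 'rV[R]_(d i)) (p : 'I_k -> {poly R}) :
  (forall i, ehrhart_factor (A i) (p i)) -> ehrhart_factor (prodn A) (\prod_i p i).
Proof.
move=> F; split.
- by apply: convex_prodn => i; exact: factor_convex (F i).
- move=> x Ax.
  have /prodn_conv : prodn (fun i => conv [set intpt R z | z in lattice_points (A i)]) x.
    by move=> i; exact: factor_hull (F i) _ (Ax i).
  apply: convS => y Hy.
  have /dep_choice[z Hz] : forall i, exists z, lattice_points (A i) z /\ intpt R z = submxrow y i.
    by move=> i; have [z ? <-] := Hy i; exists z.
  exists (\mxrow_i z i).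
    by rewrite lattice_points_prodn => i; rewrite mxrowK; have [] := Hz i.
  rewrite -[RHS]submxrowK; apply/mxrowP => i; rewrite mxrowK.
  by have [_ <-] := Hz i; rewrite -[in RHS](mxrowK z i); apply/rowP => j; rewrite !mxE.
- by move=> i; rewrite submxrow0; exact: factor_zero (F i).
- have /dep_choice[M HM] : forall i, exists M : 'M[R]_(d i), M \in unitmx /\ forall j, A i (row j M).
    by move=> i; have [M ? ?] := factor_basis (F i); exists M.
  exists (\mxdiag_i M i).
    (* An explicit left inverse: the column blocks of the identity, each multiplied by the inverse
       of its diagonal block. *)
    have : \mxrow_i (submxrow (1%:M : 'M[R]_(\sum_i d i)) i *m invmx (M i)) *m \mxdiag_i M i = 1%:M.
      rewrite mul_mxrow_mxdiag -[RHS]submxrowK; apply/eq_mxrowP => i.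
      by rewrite mulmxKV //; have [] := HM i.
    by move=> /mulmx1_unit[].
  move=> i j; rewrite rowE -[delta_mx 0 i]submxrowK mul_mxrow_mxdiag mxrowK.
  have [->|[l ->]] := submxrow_delta i j.
    by rewrite mul0mx; exact: factor_zero (F j).
  by rewrite -rowE; have [_] := HM j.
- move=> t t0.
  have /dep_choice[N HN] : forall i, exists N,
      listed (lattice_points (dilate t%:R (A i))) N /\ (p i).[t%:R] = N%:R.
    by move=> i; have [N ? ?] := factor_count (F i) t0; exists N.
  exists (\prod_i N i)%N.
    rewrite dilate_prodn lattice_points_prodn; apply: (listed_prodn (A := fun i => lattice_points (dilate t%:R (A i)))) => i.
    by have [] := HN i.
  rewrite horner_prod natr_prod; apply: eq_bigr => i _.
  by have [] := HN i.
Qed.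
End Prodn.
End Factors.

(** * Pyramids over a unit simplex *)

(** The lattice points of the N-th dilate of the n-dimensional unit simplex. They are taken from
    tuples over ['I_N.+1] because the cardinal of that set of tuples is a known binomial
    coefficient. *)
Definition bounded_seqs (n N : nat) : seq (seq nat) :=
  [seq [seq val x | x <- tval y]
     | y <- enum [set y : n.-tuple 'I_N.+1 | (\sum_(i <- y) i <= N)%N]%SET].

Lemma bounded_seqs_uniq n N : uniq (bounded_seqs n N).
Proof.
rewrite map_inj_uniq ?enum_uniq // => x y.
by move/(inj_map val_inj)/val_inj.
Qed.

Lemma size_bounded_seqs n N : size (bounded_seqs n N) = 'C(n + N, n).
Proof. by rewrite size_map -cardE card_partial_ord_partitions. Qed.

Lemma mem_bounded_seqs n N ys :
  (ys \in bounded_seqs n N) = (size ys == n) && (sumn ys <= N)%N.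
Proof.
apply/mapP/andP => [[y]|[/eqP sz le]].
  rewrite mem_enum inE => le ->; rewrite size_map size_tuple eqxx; split=> //.
  by rewrite sumnE big_map.
have ltN y : y \in ys -> (y < N.+1)%N.
  move=> yin; rewrite ltnS (leq_trans _ le) //.
  by rewrite sumnE (perm_big _ (perm_to_rem yin)) big_cons leq_addr.
have szt : size [seq inord y : 'I_N.+1 | y <- ys] == n by rewrite size_map sz.
have E : [seq val x | x <- [seq inord y : 'I_N.+1 | y <- ys]] = ys.
  rewrite -map_comp -[RHS]map_id; apply/eq_in_map => y yin /=.
  by rewrite inordK // ltN.
exists (Tuple szt); last by rewrite /= E.
by rewrite mem_enum inE /= -(big_map val xpredT id) E -sumnE.
Qed.

Section Pyramids.
Local Open Scope classical_set_scope.
Local Open Scope ring_scope.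
Variable R : realType.

Lemma factor_dilate n (Q : set 'rV[R]_n) p (c : nat) : (0 < c)%N ->
  ehrhart_factor Q p -> ehrhart_factor (dilate c%:R Q) (p \Po (c%:R *: 'X)).
Proof.
move=> c0 F; split.
- by apply: convex_dilate; exact: factor_convex F.
- move=> _ [x Qx <-].
  have := @dilate_conv R n c%:R [set intpt R z | z in lattice_points Q] (c%:R *: x).
  move=> H; have {}H := H (ex_intro2 _ _ x (factor_hull F Qx) erefl).
  apply: convS H => _ [_ [z Qz <-] <-]; exists (c%:R *: z); last first.
    by apply/rowP => j; rewrite !mxE rmorphM /= rmorph_nat.
  exists (intpt R z) => //.
  by apply/rowP => j; rewrite !mxE rmorphM /= rmorph_nat.
- by exists 0; [exact: factor_zero F|rewrite scaler0].
- have [M uM QM] := factor_basis F; exists (c%:R *: M).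
    by rewrite unitmxZ // unitfE pnatr_eq0 -lt0n.
  by move=> i; exists (row i M) => //; apply/rowP => j; rewrite !mxE.
- move=> t t0; have ct0 : (0 < t * c)%N by rewrite muln_gt0 t0.
  have [N lN pN] := factor_count F ct0; exists N.
    by rewrite dilate_dilate -natrM.
  by rewrite horner_comp hornerZ hornerX -natrM mulnC.
Qed.

Definition rows_hull n (B : 'M[R]_n) : set 'rV[R]_n :=
  conv ([set 0] `|` range (fun i => row i B)).

Lemma rows_hullP n (B : 'M[R]_n) x : rows_hull B x <->
  exists y : 'rV[R]_n, [/\ forall i, 0 <= y 0 i, \sum_i y 0 i <= 1 & x = y *m B].
Proof.
split.
  pose C := [set x | exists y : 'rV[R]_n,
    [/\ forall i, 0 <= y 0 i, \sum_i y 0 i <= 1 & x = y *m B]].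
  suff : rows_hull B `<=` C by apply.
  apply: conv_subset.
    move=> N w v w0 w1 /dep_choice[y Hy]; exists (\sum_i w i *: y i); split.
    - move=> j; rewrite summxE sumr_ge0 // => i _; rewrite scalemxE mulr_ge0 //.
      by have [] := Hy i.
    - under eq_bigr do rewrite summxE.
      rewrite exchange_big /= -[leRHS]w1 ler_sum // => i _.
      under eq_bigr do rewrite scalemxE.
      by rewrite -mulr_sumr -[leRHS]mulr1 ler_wpM2l //; have [] := Hy i.
    - rewrite mulmx_suml; apply: eq_bigr => i _.
      by have [_ _ {1}->] := Hy i; rewrite scalemxAl.
  move=> _ [->|[i _ <-]].
    exists 0; split=> [i||]; rewrite ?mxE ?mul0mx //.
    by rewrite big1 // => i _; rewrite mxE.
  exists (delta_mx 0 i); split=> [j||]; rewrite -?rowE ?mxE //.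
  rewrite (bigD1 i) //= big1 ?mxE ?eqxx ?addr0 // => j ji.
  by rewrite mxE (negPf ji) andbF.
move=> [y [y0 y1 ->]].
(* The origin, indexed by [None], absorbs the slack 1 - sum of y. *)
pose w (o : option 'I_n) := if o is Some i then y 0 i else 1 - \sum_i y 0 i.
pose v (o : option 'I_n) := if o is Some i then row i B else 0.
have E (V : zmodType) (F : option 'I_n -> V) : \sum_o F o = F None + \sum_i F (Some i).
  rewrite (bigD1 None) //=; congr (_ + _).
  rewrite (reindex_omap Some id) //=; last by case.
  by apply: eq_bigl => i; rewrite eqxx.
have -> : y *m B = \sum_o w o *: v o.
  rewrite E /= scaler0 add0r; apply/rowP => j.
  by rewrite summxE mxE; apply: eq_bigr => i _; rewrite !mxE.
apply: conv_fin.
- by case=> [i|] //=; rewrite subr_ge0.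
- by rewrite E /= subrK.
- by case=> [i|] /=; [right; exists i|left].
Qed.

(** Both $\mathcal{S}_d(m)$ for d >= 2 and the Reeve tetrahedron are hulls of 0, all unit vectors
    but the last, and one apex [a]. The matrix is lower triangular, with the last coordinate of the
    apex as its only diagonal entry that may differ from 1. The ring is arbitrary because both
    integer and real apexes occur. *)
Definition pyramid_mx (K : nzRingType) n (a : 'rV[K]_n.+1) : 'M[K]_n.+1 :=
  \matrix_(i, j) if i == ord_max then a 0 j else (i == j)%:R.

Lemma pyramid_mx_unit n (a : 'rV[R]_n.+1) : a 0 ord_max != 0 ->
  pyramid_mx a \in unitmx.
Proof.
move=> a0; rewrite unitmxE det_trig.
  rewrite big_ord_recr /= unitrM; apply/andP; split; last first.
    by rewrite mxE eqxx unitfE.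
  rewrite big1 ?unitr1 // => i _; rewrite mxE eqxx ifF //.
  by apply/negbTE; rewrite -val_eqE /= neq_ltn ltn_ord.
apply/is_trig_mxP => i j ij; rewrite mxE ifF; last first.
  by apply/negbTE; rewrite -val_eqE /= neq_ltn (leq_trans ij) // -ltnS ltn_ord.
by rewrite -val_eqE /= (ltn_eqF ij).
Qed.

Definition pyramid n (a : 'rV[R]_n.+1) : set 'rV[R]_n.+1 := rows_hull (pyramid_mx a).

(** In the basis of the rows of [pyramid_mx a], the apex has coefficient l, read off from the last
    coordinate, and the unit vectors have coefficients x_i - l a_i. The conditions say that these
    are nonnegative and sum to at most c. *)
Lemma dilate_pyramidP n (a : 'rV[R]_n.+1) (c : R) x : 0 < c -> 0 < a 0 ord_max ->
  dilate c (pyramid a) x <->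
  let l := x 0 ord_max / a 0 ord_max in
  [/\ 0 <= l, forall i : 'I_n, l * a 0 (widen_ord (leqnSn n) i) <= x 0 (widen_ord (leqnSn n) i)
    & \sum_(i < n) x 0 (widen_ord (leqnSn n) i)
        <= c + l * (\sum_(i < n) a 0 (widen_ord (leqnSn n) i) - 1)].
Proof.
move=> c0 h0; set wi := widen_ord (leqnSn n); set h := a 0 ord_max in h0 *.
have h1 : h != 0 by rewrite gt_eqF.
have c1 : c != 0 by rewrite gt_eqF.
have wm i : (wi i == ord_max) = false by rewrite -val_eqE /= ltn_eqF.
have yBw (y : 'rV[R]_n.+1) i : (y *m pyramid_mx a) 0 (wi i) = y 0 (wi i) + y 0 ord_max * a 0 (wi i).
  rewrite mxE big_ord_recr /= -/wi mxE eqxx; congr (_ + _).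
  rewrite (bigD1 i) //= -/wi mxE wm eqxx mulr1 big1 ?addr0 // => j ji.
  rewrite mxE -/wi wm -val_eqE /= val_eqE (negPf ji) mulr0 //.
have yBm (y : 'rV[R]_n.+1) : (y *m pyramid_mx a) 0 ord_max = y 0 ord_max * h.
  rewrite mxE big_ord_recr /= -/wi mxE eqxx big1 ?add0r // => j _.
  by rewrite mxE -/wi !wm mulr0.
split.
  move=> [_ /rows_hullP[y [y0 y1 ->]] <-] /=.
  have l1 : (c *: (y *m pyramid_mx a)) 0 ord_max / h = c * y 0 ord_max.
    by rewrite scalemxE yBm mulrA mulfK.
  rewrite l1; split.
  - by rewrite mulr_ge0 // ltW.
  - by move=> i; rewrite scalemxE yBw mulrDr mulrA lerDr mulr_ge0 // ltW.
  - under eq_bigr do rewrite scalemxE yBw.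
    rewrite -mulr_sumr big_split /= -mulr_sumr.
    move: y1; rewrite big_ord_recr /= -/wi => y1.
    set S1 := \sum_(i < n) y 0 _ in y1 *; set S2 := \sum_(i < n) a 0 _.
    have := ler_wpM2l (ltW c0) y1; lra.
move=> /= [l0 xi sx]; set l := x 0 ord_max / h in l0 xi sx.
pose y : 'rV[R]_n.+1 := \row_j if j == ord_max then l / c else (x 0 j - l * a 0 j) / c.
have ym : y 0 ord_max = l / c by rewrite mxE eqxx.
have yw i : y 0 (wi i) = (x 0 (wi i) - l * a 0 (wi i)) / c by rewrite mxE wm.
have jP (j : 'I_n.+1) : j = ord_max \/ exists i, j = wi i.
  case: (ltnP j n) => jn; [right|left].
    by exists (Ordinal jn); apply: val_inj.
  by apply: val_inj => /=; have := ltn_ord j; lia.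
exists (y *m pyramid_mx a).
  apply/rows_hullP; exists y; split=> //.
    move=> j; have [->|[i ->]] := jP j; rewrite ?ym ?yw divr_ge0 ?(ltW c0) //.
    by rewrite subr_ge0.
  rewrite big_ord_recr /= -/wi ym.
  under eq_bigr do rewrite yw.
  rewrite -mulr_suml -mulrDl ler_pdivrMr // mul1r sumrB -mulr_sumr.
  move: sx; set S1 := \sum_(i < n) x 0 _; set S2 := \sum_(i < n) a 0 _; lra.
apply/rowP => j; rewrite scalemxE; have [->|[i ->]] := jP j.
  by rewrite yBm ym /l; field; rewrite c1 h1.
by rewrite yBw yw ym; field; rewrite c1.
Qed.

(** * Counting lattice points of a dilated pyramid by slices of the last coordinate *)

Section PyramidCount.
Variables (n : nat) (a : 'rV[R]_n.+1) (t : nat).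
Variables (f : nat -> nat -> int) (g : nat -> int) (H : nat -> nat) (Zmax : nat).
Hypothesis n_gt0 : (0 < n)%N.
Hypothesis t_gt0 : (0 < t)%N.
Hypothesis h_gt0 : 0 < a 0 ord_max.
Let wi := widen_ord (leqnSn n).
Hypothesis fP : forall Z (i : 'I_n) (x : int),
  (Z%:R / a 0 ord_max * a 0 (wi i) <= x%:~R) = (f Z i <= x).
Hypothesis gP : forall Z (x : int),
  (x%:~R <= Z%:R / a 0 ord_max * (\sum_(i < n) a 0 (wi i) - 1)) = (x <= g Z).
Hypothesis HP : forall Z, \sum_(i < n) f Z i - g Z = (H Z)%:Z.
Hypothesis Zmax_P : forall Z, (Zmax <= Z)%N -> (t < H Z)%N.

(** By [fP] and [gP], [f] is the ceiling of the lower bound of a coordinate and [g] the floor of the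
    bound on the coordinate sum, so the real inequalities of [dilate_pyramidP] become integral. *)
Lemma lattice_pyramidP z : lattice_points (dilate t%:R (pyramid a)) z <->
  exists2 Z : nat, z 0 ord_max = Z%:Z &
    (forall i : 'I_n, f Z i <= z 0 (wi i)) /\ \sum_(i < n) z 0 (wi i) - t%:Z <= g Z.
Proof.
rewrite /lattice_points /=; split.
  move=> /(dilate_pyramidP _ _ h_gt0); rewrite ltr0n => /(_ t_gt0) /= [].
  rewrite !mxE => l0 li ls.
  have z0 : 0 <= z 0 ord_max.
    by move: l0; rewrite pmulr_lge0 ?invr_gt0 // ler0z.
  case: (z 0 ord_max) z0 l0 li ls => [Z|//] _ _ li ls; exists Z => //.
  split=> [i|]; first by rewrite -fP; have := li i; rewrite mxE.
  rewrite -gP rmorphB rmorph_sum /= lerBlDl.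
  by move: ls; under eq_bigr do rewrite mxE.
move=> [Z zZ [zi zs]]; apply/dilate_pyramidP => //; first by rewrite ltr0n.
rewrite /= !mxE zZ; split.
- by rewrite divr_ge0 ?ler0z // ltW.
- by move=> i; rewrite mxE fP.
- under eq_bigr do rewrite mxE.
  by move: zs; rewrite -gP rmorphB rmorph_sum /= lerBlDl.
Qed.

(** Subtracting [f Z] turns the slice at height Z into the lattice points of a unit simplex of size
    t - H Z. When H Z > t the slice is empty, and the binomial with truncated subtraction is 0
    because n > 0. *)
Lemma pyramid_count :
  listed (lattice_points (dilate t%:R (pyramid a)))
    (\sum_(0 <= Z < Zmax) 'C(t + n - H Z, n)).
Proof.
pose mk (Z : nat) (y : seq nat) : 'rV[int]_n.+1 :=
  \row_(j < n.+1) if (j < n)%N then f Z j + (nth 0%N y j)%:Z else Z%:Z.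
have mkw Z y i : mk Z y 0 (wi i) = f Z i + (nth 0%N y i)%:Z by rewrite mxE /= ltn_ord.
have mkm Z y : mk Z y 0 ord_max = Z%:Z by rewrite mxE /= ltnn.
pose zs := [seq Z <- iota 0 Zmax | (H Z <= t)%N].
exists [seq mk Z y | Z <- zs, y <- bounded_seqs n (t - H Z)]; split.
- apply: allpairs_uniq_dep.
  + by rewrite filter_uniq ?iota_uniq.
  + by move=> Z _; exact: bounded_seqs_uniq.
  + move=> _ _ /allpairsPdep[Z [y [_ yin ->]]] /allpairsPdep[Z' [y' [_ yin' ->]]] /=.
    move=> E; have ZZ : Z = Z'.
      by move/matrixP: (E) => /(_ 0 ord_max); rewrite !mkm => -[].
    move: E; rewrite -{}ZZ in yin' * => E; congr (Tagged _ _).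
    move: yin yin'; rewrite !mem_bounded_seqs => /andP[/eqP sy _] /andP[/eqP sy' _].
    apply: (@eq_from_nth _ 0%N); first by rewrite sy.
    move=> i; rewrite sy => iN.
    move/matrixP: E => /(_ 0 (wi (Ordinal iN))); rewrite !mkw /= => /addrI.
    by case.
- rewrite size_allpairs_dep sumnE big_map big_filter big_mkcond /= /index_iota subn0.
  apply: eq_bigr => Z _; rewrite size_bounded_seqs; case: leqP => le.
    by congr binomial; lia.
  by rewrite bin_small //; lia.
- move=> z; split.
    move=> /lattice_pyramidP[Z zZ [zi zsum]].
    pose y := [seq absz (z 0 (wi i) - f Z i)%R | i <- enum 'I_n].
    have yz (i : 'I_n) : (nth 0%N y i)%:Z = z 0 (wi i) - f Z i.
      rewrite (nth_map i) ?size_enum_ord // nth_ord_enum gez0_abs ?subr_ge0 //.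
    have sumy : (sumn y)%:Z = \sum_(i < n) z 0 (wi i) - \sum_(i < n) f Z i.
      rewrite sumnE big_map big_enum /= -sumrB rmorph_sum /=.
      by apply: eq_bigr => i _; rewrite gez0_abs ?subr_ge0.
    have := HP Z => HZ.
    have le : (sumn y + H Z <= t)%N.
      rewrite -lez_nat PoszD sumy -HZ; lra.
    apply/allpairsPdep; exists Z, y; split.
    + rewrite mem_filter mem_iota /= add0n; apply/andP; split; first by lia.
      by rewrite ltnNge; apply/negP => /Zmax_P; lia.
    + by rewrite mem_bounded_seqs size_map size_enum_ord eqxx /=; lia.
    + apply/rowP => j; rewrite mxE; case: ltnP => jn.
        have -> : j = wi (Ordinal jn) by apply: val_inj.
        by rewrite (yz (Ordinal jn)) addrC subrK.
      by rewrite -zZ; congr (z 0 _); apply: val_inj => /=; have := ltn_ord j; lia.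
  move=> /allpairsPdep[Z [y [zin]]].
  rewrite mem_bounded_seqs => /andP[/eqP sy le] ->.
  move: zin; rewrite mem_filter => /andP[HZ _].
  apply/lattice_pyramidP; exists Z => //; split=> [i|].
    by rewrite mkw lerDl.
  under eq_bigr do rewrite mkw.
  rewrite big_split /=.
  have -> : \sum_(i < n) (nth 0%N y i)%:Z = (sumn y)%:Z.
    by rewrite sumnE (big_nth 0%N) big_mkord sy rmorph_sum.
  have := HP Z; move: le; rewrite -lez_nat -subzn // => le HZ'; lra.
Qed.

End PyramidCount.

(** Reduces everything to the count: an integral apex makes all vertices lattice points, and a
    positive last coordinate makes the vertices other than 0 a basis. *)
Lemma factor_pyramid n (a : 'rV[int]_n.+1) p : 0 < a 0 ord_max ->
  (forall t : nat, (0 < t)%N -> exists2 N,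
     listed (lattice_points (dilate t%:R (pyramid (intpt R a)))) N & p.[t%:R] = N%:R) ->
  ehrhart_factor (pyramid (intpt R a)) p.
Proof.
move=> a0 Hp; split=> //.
- exact: convex_conv.
- apply: convS => x Hx; have Qx := sub_conv Hx.
  suff [z zx] : exists z, intpt R z = x by exists z => //; rewrite /lattice_points /= zx.
  case: Hx => [->|[i _ <-]]; first by exists 0; rewrite /intpt map_mx0.
  exists (row i (pyramid_mx a)); apply/rowP => j; rewrite !mxE.
  by case: ifP => _ //; rewrite rmorph_nat.
- by apply: sub_conv; left.
- exists (pyramid_mx (intpt R a)).
    by apply: pyramid_mx_unit; rewrite mxE intr_eq0 gt_eqF.
  by move=> i; apply: sub_conv; right; exists i.
Qed.

End Pyramids.

(** * Ehrhart polynomials of the simplices and of the Reeve tetrahedron *)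

Definition ceildivn (Z q : nat) : nat := (Z %/ q + (0 < Z %% q))%N.

Section EhrhartFactors.
Local Open Scope classical_set_scope.
Local Open Scope ring_scope.
Variable R : realType.

Lemma ler_int_div (x : int) (Z q : nat) : (0 < q)%N ->
  (x%:~R <= Z%:R / q%:R :> R) = (x <= (Z %/ q)%:Z).
Proof.
move=> q0; rewrite ler_pdivlMr ?ltr0n // -[q%:R]/(q%:~R) -[Z%:R]/(Z%:~R).
rewrite -intrM ler_int; case: x => x; first by rewrite -PoszM !lez_nat leq_divRL.
by apply/idP/idP; nia.
Qed.

Lemma ler_div_int (x : int) (Z q : nat) : (0 < q)%N ->
  (Z%:R / q%:R <= x%:~R :> R) = ((ceildivn Z q)%:Z <= x).
Proof.
move=> q0; rewrite ler_pdivrMr ?ltr0n // -[q%:R]/(q%:~R) -[Z%:R]/(Z%:~R).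
rewrite -intrM ler_int /ceildivn; have := divn_eq Z q; have := ltn_pmod Z q0.
move: (Z %/ q)%N (Z %% q)%N => u s sq ->.
by apply/idP/idP; case: (posnP s) => s0 /=; nia.
Qed.

(** Each quotient u occurs once with remainder 0 and m - 1 times with a positive remainder. *)
Lemma sum_div_split (m U : nat) (F : nat -> bool -> nat) : (0 < m)%N ->
  (\sum_(0 <= Z < U * m) F (Z %/ m) (0 < Z %% m) =
   \sum_(0 <= u < U) F u false + m.-1 * \sum_(0 <= u < U) F u true)%N.
Proof.
move=> m0; rewrite sum_nat_mul big_distrr -big_split /=.
apply: eq_bigr => u _; case: m m0 => // m _.
rewrite big_nat_recl // addn0 mulnK // modnMl /=; congr addn.
rewrite (@eq_big_nat _ _ _ 0 m _ (fun=> F u true)); last first.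
  move=> s /andP[_ sm]; rewrite divnMDl // divn_small ?addn0 //.
  by rewrite modnMDl modn_small.
by rewrite sum_nat_const_nat subn0.
Qed.

(** This is (t+1)^d + (m-1) t^d, kept expanded because the sign analysis reads off its
    coefficients. *)
Definition simplex_poly (d m : nat) : {poly R} :=
  m%:R *: 'X^d + \sum_(l < d) 'C(d, l)%:R *: 'X^l.

Lemma horner_simplex_poly d m t :
  (simplex_poly d m.+1).[t%:R] = (t.+1 ^ d + m * t ^ d)%:R.
Proof.
rewrite /simplex_poly hornerD hornerZ hornerXn horner_sum.
under eq_bigr do rewrite hornerZ hornerXn.
rewrite natrD natrM !natrX -[t.+1%:R]natr1 -[m.+1%:R]natr1 exprD1n big_ord_recr /=.
rewrite binn mulr1n [in RHS](eq_bigr (fun l : 'I_d => 'C(d, l)%:R * t%:R ^+ l)); last first.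
  by move=> l _; rewrite mulr_natl.
ring.
Qed.

Lemma height_ge n T u : (T * n.+1`! <= u)%N -> (T <= height n u)%N.
Proof. by move=> H; rewrite -(subnKC H) height_shift leq_addr. Qed.

(** For Z = u m + s the coordinate bounds are the negated floors of u by [fden i], and the bound on
    their sum is the negated ceiling of Z/m. The deficit is thus [height n u], plus one if s > 0. By
    Worpitzky's identity the residue s = 0 contributes (t+1)^d and each of the m - 1 others t^d. *)
Lemma factor_Ssimplex d m : (2 <= d)%N -> (0 < m)%N ->
  ehrhart_factor (Ssimplex (d := d) (m%:R : R)) (simplex_poly d m).
Proof.
case: d => [//|[//|n']] _ m0; set n := n'.+1.
pose a : 'rV[int]_n.+1 := \row_(j < n.+1)
  if (j < n)%N then - (n.+1`! %/ fden j)%:Z else (n.+1`! * m)%:Z.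
have aw i : intpt R a 0 (widen_ord (leqnSn n) i) = - (n.+1`!%:R / (fden i)%:R).
  rewrite !mxE /= ltn_ord rmorphN /= -pmulrn; congr (- _).
  rewrite -[in RHS](divnK (fden_dvd_fact (ltn_ord i))) natrM mulfK //.
  by rewrite pnatr_eq0 -lt0n fden_gt0.
have am : intpt R a 0 ord_max = (n.+1`! * m)%:R by rewrite !mxE /= ltnn.
have am0 : 0 < intpt R a 0 ord_max by rewrite am ltr0n muln_gt0 fact_gt0.
have apexE : apex n.+1 (m%:R : R) = intpt R a.
  apply/rowP => j; rewrite mxE /=; case: (ltnP j n) => jn.
    have -> : j = widen_ord (leqnSn n) (Ordinal jn) by apply: val_inj.
    by rewrite aw /= ltn_eqF // /qcoef.
  have -> : j = ord_max by apply: val_inj => /=; have := ltn_ord j; lia.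
  by rewrite am /= eqxx natrM.
have -> : Ssimplex (d := n.+1) (m%:R : R) = pyramid (intpt R a).
  rewrite /Ssimplex /pyramid /rows_hull; congr conv; rewrite apexE -setUA; congr (_ `|` _).
  have rowi (i : 'I_n.+1) : (i < n)%N -> row i (pyramid_mx (intpt R a)) = delta_mx 0 i.
    move=> ilt; apply/rowP => j; rewrite !mxE ifF ?eqxx /= ?[i == j]eq_sym //.
    by apply/negbTE; rewrite -val_eqE /= ltn_eqF.
  have rowm : row ord_max (pyramid_mx (intpt R a)) = intpt R a.
    by apply/rowP => j; rewrite mxE mxE eqxx.
  apply/seteqP; split=> x.
    by move=> [[i /= ilt <-]|->]; [exists i; rewrite ?rowi|exists ord_max].
  move=> [i _ <-]; case: (ltnP i n) => ilt; first by left; exists i; rewrite ?rowi.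
  suff -> : i = ord_max by right; rewrite rowm.
  by apply: val_inj => /=; have := ltn_ord i; lia.
apply: factor_pyramid; first by move: am0; rewrite mxE ltr0z.
move=> t t0; pose H Z := (height n (Z %/ m) + (0 < Z %% m))%N.
pose f Z j : int := - (Z %/ (m * fden j))%:Z.
pose g Z : int := - (ceildivn Z m)%:Z.
have cancelF (x y z w : R) : y != 0 -> z != 0 -> w != 0 ->
    x / (y * z) * - (y / w) = - (x / (z * w)).
  by move=> y0 z0 w0; field; rewrite y0 z0 w0.
have F0 : (n.+1`!%:R : R) != 0 by rewrite pnatr_eq0 -lt0n fact_gt0.
have m1 : (m%:R : R) != 0 by rewrite pnatr_eq0 -lt0n.
(* From this cut-off on the height of Z divided by m is at least t + 1, so all further slices are
   empty. *)
exists (\sum_(0 <= Z < t.+1 * n.+1`! * m) 'C(t + n - H Z, n))%N.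
  apply: (@pyramid_count _ _ _ _ f g H) => //.
  - move=> Z i x; rewrite aw am /f.
    have -> : Z%:R / (n.+1`! * m)%:R * - (n.+1`!%:R / (fden i)%:R) = - (Z%:R / (m * fden i)%:R) :> R.
      have f1 : ((fden i)%:R : R) != 0 by rewrite pnatr_eq0 -lt0n fden_gt0.
      by rewrite (natrM _ _ m) (natrM _ m); apply: cancelF.
    by rewrite lerNl -rmorphN ler_int_div ?muln_gt0 ?m0 ?fden_gt0 // lerNl.
  - move=> Z x; rewrite am /g.
    have -> : \sum_(i < n) intpt R a 0 (widen_ord (leqnSn n) i) - 1 = - n.+1`!%:R.
      under eq_bigr do rewrite aw.
      rewrite sumrN -opprD; congr (- _).
      rewrite -[in RHS](sum_fact_div_fden n) natrD natr_sum; congr (_ + _).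
      apply: eq_bigr => i _; rewrite -[in LHS](divnK (fden_dvd_fact (ltn_ord i))).
      by rewrite natrM mulfK // pnatr_eq0 -lt0n fden_gt0.
    have -> : Z%:R / (n.+1`! * m)%:R * - n.+1`!%:R = - (Z%:R / m%:R) :> R.
      have := @cancelF Z%:R _ m%:R 1 F0 m1 (oner_neq0 _).
      by rewrite natrM divr1 mulr1.
    by rewrite lerNr -rmorphN ler_div_int // lerNr.
  - move=> Z; rewrite /f /g /H /ceildivn sumrN opprK.
    have -> : \sum_(i < n) (Z %/ (m * fden i))%:Z = (divsum n (Z %/ m))%:Z.
      rewrite /divsum rmorph_sum /=; apply: eq_bigr => i _.
      by rewrite divnMA.
    have := heightE n (Z %/ m); lia.
  - move=> Z; rewrite -leq_divRL // => /height_ge; rewrite /H; lia.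
rewrite /H (@sum_div_split _ _ (fun u b => 'C(t + n - (height n u + b), n))) //.
case: m {a aw am am0 apexE H f g m1} m0 => // m _; rewrite horner_simplex_poly /=.
congr (_%:R); congr (_ + _ * _)%N.
  rewrite -[LHS](@worpitzky_height n t t.+1) //.
  by apply: eq_bigr => u _; rewrite addn0.
(* The extra unit of deficit for s > 0 lowers t by one in Worpitzky's identity; the cut-off is then
   larger than necessary, which does not change the sum. *)
case: t t0 => // t _; rewrite -(@worpitzky_height n t t.+2) //.
by apply: eq_bigr => u _; congr binomial; lia.
Qed.

Definition reeve_poly (m : nat) : {poly R} :=
  (m%:R / 6) *: 'X^3 + 'X^2 + (2 - m%:R / 6) *: 'X + 1.

(** The hockey-stick identity; the right-hand side is the binomial coefficient of t+3 over 3. *)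
Lemma sum_binomial2 t :
  (\sum_(0 <= u < t.+1) 'C(t + 2 - u, 2))%:R = (t%:R + 1) * (t%:R + 2) * (t%:R + 3) / 6 :> R.
Proof.
elim: t => [|t IH]; first by rewrite big_nat1 /= binn; field.
rewrite big_nat_recl // natrD.
have -> : (\sum_(0 <= u < t.+1) 'C(t.+1 + 2 - u.+1, 2) = \sum_(0 <= u < t.+1) 'C(t + 2 - u, 2))%N.
  by apply: eq_bigr => u _; congr binomial; lia.
rewrite {}IH subn0 -[t.+1%:R]natr1.
have -> : ('C(t.+1 + 2, 2)%:R = (t%:R + 3) * (t%:R + 2) / 2 :> R).
  have : ('C(t.+1 + 2, 2) * 2 = (t + 3) * (t + 2))%N.
    by rewrite -[X in (_ * X)%N]/(2`!) bin_ffact ffactnS ffactn1; nia.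
  move=> /(congr1 (fun x => x%:R : R)); rewrite !natrM !natrD => <-; by field.
by field.
Qed.

(** For Z = u m + s both base coordinates are at least the ceiling of Z/m and their sum, less t, is
    at most the floor, so the deficit is u, plus 2 if s > 0. Residue 0 gives C(t+3,3) and each other
    residue C(t+1,3). *)
Lemma factor_reeve m : (0 < m)%N ->
  ehrhart_factor (reeve (m%:R : R)) (reeve_poly m).
Proof.
move=> m0.
pose a : 'rV[int]_3 := \row_(j < 3) if (j < 2)%N then 1 else m%:Z.
have aw i : intpt R a 0 (widen_ord (leqnSn 2) i) = 1 by rewrite !mxE /= ltn_ord.
have am : intpt R a 0 ord_max = m%:R by rewrite !mxE.
have am0 : 0 < intpt R a 0 ord_max by rewrite am ltr0n.
have -> : reeve (m%:R : R) = pyramid (intpt R a).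
  have r0 : row 0 (pyramid_mx (intpt R a)) = vec3 1 0 0.
    by apply/rowP => j; rewrite !mxE /=; case: j => -[|[|[|//]]].
  have r1 : row 1 (pyramid_mx (intpt R a)) = vec3 0 1 0.
    by apply/rowP => j; rewrite !mxE /=; case: j => -[|[|[|//]]].
  have r2 : row 2 (pyramid_mx (intpt R a)) = vec3 1 1 m%:R.
    by apply/rowP => j; rewrite !mxE /=; case: j => -[|[|[|//]]].
  have z0 : vec3 0 0 0 = 0 :> 'rV[R]_3.
    by apply/rowP => j; rewrite !mxE /=; case: j => -[|[|[|//]]].
  rewrite /reeve /pyramid /rows_hull; congr conv; rewrite z0.
  apply/seteqP; split=> x /=.
    move=> [[[->|->]|->]|->]; [by left|right; exists 0|right; exists 1|right; exists 2] => //.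
  move=> [->|[i _ <-]]; first by left; left; left.
  case: i => -[|[|[|//]]] i3.
  - by left; left; right; rewrite -r0; congr row; apply: val_inj.
  - by left; right; rewrite -r1; congr row; apply: val_inj.
  - by right; rewrite -r2; congr row; apply: val_inj.
apply: factor_pyramid; first by move: am0; rewrite mxE ltr0z.
move=> t t0; pose H Z := (Z %/ m + 2 * (0 < Z %% m))%N.
pose f Z (_ : nat) : int := (ceildivn Z m)%:Z.
pose g Z : int := (Z %/ m)%:Z.
have m1 : (m%:R : R) != 0 by rewrite pnatr_eq0 -lt0n.
exists (\sum_(0 <= Z < t.+1 * m) 'C(t + 2 - H Z, 2))%N.
  apply: (@pyramid_count _ _ _ _ f g H) => //.
  - by move=> Z i x; rewrite aw am mulr1 ler_div_int.
  - move=> Z x; under eq_bigr do rewrite aw.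
    by rewrite am sumr_const card_ord mulr2n addrK mulr1 ler_int_div.
  - move=> Z; rewrite /f /g /H /ceildivn sumr_const card_ord; lia.
  - by move=> Z; rewrite -leq_divRL // /H; lia.
rewrite /H (@sum_div_split _ _ (fun u b => 'C(t + 2 - (u + 2 * b), 2))) //.
rewrite natrD natrM.
have -> : (\sum_(0 <= u < t.+1) 'C(t + 2 - (u + 2 * false), 2) =
           \sum_(0 <= u < t.+1) 'C(t + 2 - u, 2))%N.
  by apply: eq_bigr => u _; rewrite muln0 addn0.
rewrite sum_binomial2.
have -> : ((\sum_(0 <= u < t.+1) 'C(t + 2 - (u + 2 * true), 2))%:R =
           (t%:R - 1) * t%:R * (t%:R + 1) / 6 :> R).
  case: t t0 {H f g} => // -[|t] _.
    by rewrite big_nat_recr // big_nat1 !bin_small // subrr !mul0r.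
  rewrite big_nat_recr // big_nat_recr //= !bin_small ?addn0; try lia.
  rewrite (eq_bigr (fun u => 'C(t + 2 - u, 2))); last first.
    by move=> u _; congr binomial; lia.
  by rewrite sum_binomial2 -[t.+2%:R]natr1 -[t.+1%:R]natr1; field.
rewrite /reeve_poly !hornerE /= -[in LHS](prednK m0) -[m.-1.+1%:R]natr1.
by field.
Qed.

End EhrhartFactors.

(** * Dominant terms *)

Definition update (k : nat) (T : Type) (l : 'I_k -> T) i0 v : 'I_k -> T :=
  fun i => if i == i0 then v else l i.

Lemma update_in (k : nat) (T : Type) (l : 'I_k -> T) i0 v : update l i0 v i0 = v.
Proof. by rewrite /update eqxx. Qed.

Lemma update_out (k : nat) (T : Type) (l : 'I_k -> T) i0 v i :
  i != i0 -> update l i0 v i = l i.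
Proof. by rewrite /update => /negPf ->. Qed.

Lemma sum_update (V : zmodType) (k : nat) (T : Type) (F : 'I_k -> T -> V) l i0 v :
  \sum_i F i (update l i0 v i) = \sum_i F i (l i) + (F i0 v - F i0 (l i0)).
Proof.
rewrite (bigD1 i0) //= [in RHS](bigD1 i0) //= update_in.
rewrite (eq_bigr (fun i => F i (l i))); last by move=> i ii; rewrite update_out.
set S := \sum_(i | i != i0) _.
by rewrite [RHS]addrC addrA subrK.
Qed.

Lemma sumn_update (k : nat) (l : 'I_k -> nat) i0 v :
  (\sum_i update l i0 v i + l i0 = \sum_i l i + v)%N.
Proof.
rewrite (bigD1 i0) //= [in RHS](bigD1 i0) //= update_in.
rewrite (eq_bigr l); last by move=> i ii; rewrite update_out.
lia.
Qed.

(** * Comparing exponents of r by moving units of degree between factors *)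

Section Exchange.
Variables (k : nat) (d : 'I_k -> nat) (x : 'I_k -> rat) (dl : rat).
Hypothesis d_ge2 : forall i, (2 <= d i)%N.
Hypothesis dl_gt0 : 0 < dl.
Hypothesis dl_le : forall i, 4 * dl <= x i.
Hypothesis x_le : forall i, x i <= 1 / 3.
Hypothesis x_dec : forall i p : 'I_k, (i < p)%N -> 3 * x p <= x i.

(* Exponents of r, normalised by subtracting the degree in t. *)
Definition weight (i : 'I_k) (l : nat) : rat :=
  - x i * (l%:R - (l == d i)%:R) + 2 * dl * (l == d i)%:R.

(** The exponents of the Reeve factor relative to the degree: 0, dl, -1, dl - 1 for l = 0, 1, 2, 3.
    The exponent of m_0 enters exactly at the odd degrees. *)
Definition weight0 (l : nat) : rat := - l%:R / 2 + (odd l)%:R * (1 / 2 + dl).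

Definition tailsum (j : 'I_k) : nat := \sum_(i < k | (j <= i)%N) d i.

Lemma x_gt0 i : 0 < x i.
Proof. have dl0 := dl_gt0; have := dl_le i; lra. Qed.

Lemma weight_small i l : (l < d i)%N -> weight i l = - x i * l%:R.
Proof. by move=> ld; rewrite /weight (ltn_eqF ld) subr0 mulr0 addr0. Qed.

Lemma weight_full i : weight i (d i) = - x i * ((d i)%:R - 1) + 2 * dl.
Proof. by rewrite /weight eqxx mulr1. Qed.

Lemma weight_succ i l : (l < d i)%N -> weight i l - 1 / 3 <= weight i l.+1.
Proof.
move=> ld; have dl0 := dl_gt0; rewrite (weight_small ld); have x0 := x_gt0 i; have x1 := x_le i.
have [E|N] := eqVneq l.+1 (d i).
  rewrite E weight_full -E -[l.+1%:R]natr1; lra.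
rewrite weight_small; last by lia.
rewrite -[l.+1%:R]natr1; lra.
Qed.

(** Units taken from the Reeve factor can be put into any block with room, at a cost of at most 1/3
    each. *)
Lemma add_unit (l : 'I_k -> nat) : (forall i, l i <= d i)%N ->
  (\sum_i l i < \sum_i d i)%N ->
  exists l' : 'I_k -> nat, [/\ forall i, (l' i <= d i)%N,
    (\sum_i l' i = (\sum_i l i).+1)%N
    & \sum_i weight i (l i) - 1 / 3 <= \sum_i weight i (l' i)].
Proof.
move=> ld lt.
have [i li] : exists i, (l i < d i)%N.
  apply/existsP; apply: contraTT lt; rewrite negb_exists -leqNgt => /forallP H.
  by apply: leq_sum => i _; rewrite leqNgt.
exists (update l i (l i).+1); split.
- by move=> j; rewrite /update; case: eqP => // ->.
- by have := sumn_update l i (l i).+1; lia.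
- by rewrite sum_update; have := weight_succ li; lra.
Qed.

(** If n is not a tail sum, every choice with l0 other than 1 is beaten by one with l0 = 1. For l0 =
    2 or 3 the surplus units move into the blocks, losing at most 1/3 each against a gain of at
    least 1. For l0 = 0 one unit is taken out of the blocks at a profit. *)
Lemma exchange (n l0 : nat) (l : 'I_k -> nat) :
  (forall i, l i <= d i)%N -> (l0 < 4)%N -> (\sum_i l i + l0 = n)%N ->
  (1 <= n <= (\sum_i d i).+1)%N -> (forall j, n != tailsum j) -> l0 != 1%N ->
  exists l' : 'I_k -> nat, [/\ forall i, (l' i <= d i)%N, (\sum_i l' i + 1 = n)%N
    & \sum_i weight i (l i) + weight0 l0 < \sum_i weight i (l' i) + weight0 1].
Proof.
move=> ld l04 ln /andP[n1 nD] nt; have dl0 := dl_gt0.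
have w1 : weight0 1 = dl by rewrite /weight0 /=; lra.
case: l0 l04 ln => [|[|[|[|//]]]] _ ln // _.
- have w0 : weight0 0 = 0 by rewrite /weight0 /=; lra.
  rewrite w0 w1.
  have [/existsP[i /andP[li0 lid]]|] := boolP [exists i, (0 < l i)%N && (l i < d i)%N].
    exists (update l i (l i).-1); split.
    + by move=> j; rewrite /update; case: eqP => // ->; lia.
    + by have := sumn_update l i (l i).-1; lia.
    + rewrite sum_update !weight_small; try lia.
      rewrite -{2}(prednK li0) -[(l i).-1.+1%:R]natr1; have := x_gt0 i; lra.
  rewrite negb_exists => /forallP part.
  have fe i : l i = 0%N \/ l i = d i.
    by have := part i; have := ld i; lia.
  (* All blocks are now empty or full. If no full block preceded an empty one, the full blocks would
     be exactly those from the first full one on, and n would be a tail sum. *)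
  have [i [p [ip li lp]]] : exists i p : 'I_k, [/\ (i < p)%N, l i = d i & l p = 0%N].
    apply: contrapT => no.
    have [j0 lj0] : exists j, l j == d j.
      case: (pickP (fun j => l j == d j)) => [j lj|H]; first by exists j.
      have : (\sum_i l i = 0)%N.
        by apply: big1 => i _; have := fe i; have := H i; lia.
      lia.
    case: (@arg_minnP _ j0 (fun j => l j == d j) (fun j : 'I_k => nat_of_ord j) lj0) => j /eqP lj jmin.
    have /eqP[] := nt j; rewrite -ln addn0 /tailsum [in RHS]big_mkcond /=.
    apply: eq_bigr => i _; case: leqP => ij; case: (fe i) => // li.
      case: (ltngtP j i) ij => // ji _; first by case: no; exists j, i.
      by rewrite -(val_inj ji).
    by have := jmin i; rewrite li eqxx leqNgt ij => /(_ isT).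
  have pi : p != i by rewrite -val_eqE gtn_eqF.
  have dp := d_ge2 p; have di := d_ge2 i.
  (* Block i gives up two units and block p receives one. With the gain dl of l0 = 1 the net change
     is x_i - x_p - dl, positive since x_i >= 3 x_p and x_p >= 4 dl. *)
  exists (update (update l i (d i - 2)%N) p 1%N); split.
  + by move=> j; rewrite /update; case: eqP => [->|_]; [lia|case: eqP => [->|_] //; lia].
  + have := sumn_update (update l i (d i - 2)%N) p 1%N.
    have := sumn_update l i (d i - 2)%N; rewrite update_out //; lia.
  + rewrite !sum_update update_out // li lp weight_full !weight_small; try lia.
    rewrite natrB //; have := x_dec ip; have := dl_le p; have := dl_le i; lra.
- have w2 : weight0 2 = -1 by rewrite /weight0 /=; lra.
  have [|l' [l'd sl' wl']] := @add_unit l ld; first by lia.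
  exists l'; split=> //; [lia|rewrite w1 w2; lra].
- have w3 : weight0 3 = dl - 1 by rewrite /weight0 /=; lra.
  have [|l' [l'd sl' wl']] := @add_unit l ld; first by lia.
  have [|l2 [l2d sl2 wl2]] := @add_unit l' l'd; first by lia.
  exists l2; split=> //; [lia|rewrite w1 w3; lra].
Qed.

Definition tail_config (j : 'I_k) (i : 'I_k) : nat := if (j <= i)%N then d i else 0%N.

Lemma tail_dominates (j : 'I_k) (l : 'I_k -> nat) :
  (forall i, l i <= d i)%N -> (\sum_i l i + 1 = tailsum j)%N ->
  \sum_i weight i (l i) + weight0 1 < \sum_i weight i (tail_config j i) + weight0 0.
Proof.
move=> ld sl; have dl0 := dl_gt0.
have w1 : weight0 1 = dl by rewrite /weight0 /=; lra.
have w0 : weight0 0 = 0 by rewrite /weight0 /=; lra.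
have sT : (\sum_i tail_config j i = tailsum j)%N by rewrite /tailsum [RHS]big_mkcond; apply: eq_bigr.
have [i1 /andP[ji1 li1]] : exists i : 'I_k, (j <= i)%N && (l i < d i)%N.
  case: (pickP (fun i : 'I_k => (j <= i)%N && (l i < d i)%N)) => [i ji|H]; first by exists i.
  suff : (tailsum j <= \sum_i l i)%N by lia.
  rewrite -sT; apply: leq_sum => i _; rewrite /tail_config; case: (leqP j i) => ji //.
  by have := H i; rewrite ji /= ltnNge => /negbFE.
have xj0 := x_gt0 j.
(* Every unit is charged the price x_j, and the unfilled block i1 records the loss of its bonus for
   being full. As [l] has one unit less than the tail, the sum of the right side is the tail weight
   minus 2 dl, which outweighs the gain dl of l0 = 1. *)
suff : \sum_i weight i (l i) <= \sum_i (weight i (tail_config j i)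
    + x j * ((tail_config j i)%:R - (l i)%:R) - (x j + 2 * dl) * (i == i1)%:R).
  move: (\sum_i weight i (l i)) => W; rewrite sumrB big_split /=.
  move: (\sum_(i < k) weight i (tail_config j i)) => W1.
  rewrite -!mulr_sumr sumrB -!natr_sum sT -sl natrD.
  have -> : (\sum_(i < k) (i == i1))%N = 1%N.
    by rewrite (bigD1 i1) //= eqxx big1 // => i /negPf ->.
  rewrite w1 w0; lra.
apply: ler_sum => i _; rewrite /tail_config; case: (leqP j i) => ji.
  have xij : x i <= x j.
    case: (ltngtP j i) ji => // [/x_dec|/val_inj ->] //; have := x_gt0 i; lra.
  have li := ld i; have xi0 := x_gt0 i; have dli := dl_le i.
  rewrite weight_full; case: (ltngtP (l i) (d i)) li => // [lt|E] _.
    rewrite weight_small //.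
    have : 0 <= (x j - x i) * ((d i)%:R - (l i)%:R - 1).
      by rewrite mulr_ge0 ?subr_ge0 // -natrB 1?ltnW // ler1n subn_gt0.
    by case: eqP => _ /=; lra.
  rewrite E weight_full; have -> : (i == i1) = false.
    by apply/negbTE/eqP => ii; move: li1; rewrite -ii E ltnn.
  rewrite /=; lra.
have -> : (i == i1) = false by apply/negbTE/eqP => ii; move: ji1; rewrite -ii leqNgt ji.
have xi := x_dec ji; have xi0 := x_gt0 i; have dlj := dl_le j; have di := d_ge2 i.
have -> : weight i 0 = 0 by rewrite weight_small ?mulr0 //; lia.
case: (ltngtP (l i) (d i)) (ld i) => // [lt|E] _.
  rewrite weight_small // /=.
  have : 0 <= (x i - x j) * (l i)%:R by rewrite mulr_ge0 // subr_ge0; lra.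
  lra.
rewrite E weight_full /=.
(* A full block before j earns the bonus 2 dl, but x_i >= 3 x_j and 3 (d_i - 1) >= d_i + 1 leave a
   surplus x_j >= 4 dl to pay for it. *)
have di' : (2 : rat) <= (d i)%:R by rewrite (ler_nat _ 2).
nra.
Qed.

End Exchange.

(** * Powers of r and sums dominated by their largest terms *)

Section Dominance.
Variable R : realType.

Lemma ratpow_gt0 r a : (0 < r)%N -> 0 < ratpow R r a.
Proof. by move=> r0; rewrite powR_gt0 // ltr0n. Qed.

Lemma ratpowD r a b : (0 < r)%N -> ratpow R r (a + b) = ratpow R r a * ratpow R r b.
Proof.
by move=> r0; rewrite /ratpow rmorphD powRD // pnatr_eq0 -lt0n r0 implybT.
Qed.

Lemma ratpow0 r : ratpow R r 0 = 1.
Proof. by rewrite /ratpow rmorph0 powRr0. Qed.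

Lemma ratpow_sum r (I : finType) (e : I -> rat) : (0 < r)%N ->
  ratpow R r (\sum_i e i) = \prod_i ratpow R r (e i).
Proof.
move=> r0; apply: (big_morph (ratpow R r)) => [a b|]; first exact: ratpowD.
exact: ratpow0.
Qed.

Lemma ratpowMn r a n : (0 < r)%N -> ratpow R r (n%:R * a) = ratpow R r a ^+ n.
Proof.
move=> r0; elim: n => [|n IH]; first by rewrite mul0r ratpow0.
by rewrite -natr1 mulrDl mul1r ratpowD // IH exprSr.
Qed.

Lemma ratpow_large (g : rat) (K : R) : 0 < g ->
  exists r0, forall r : nat, (r0 <= r)%N -> K <= ratpow R r g.
Proof.
move=> g0; have g1 : 0 < ratr g :> R by rewrite ltr0q.
pose K' := (`|K| + 1) `^ (ratr g)^-1.
exists (Num.bound K') => r rK; apply: (@le_trans _ _ (`|K| + 1)).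
  by rewrite (le_trans (ler_norm K)) // lerDl.
have -> : `|K| + 1 = K' `^ ratr g.
  by rewrite /K' -powRrM mulVf ?gt_eqF // powRr1 // addr_ge0.
apply: ge0_ler_powR; rewrite ?nnegrE ?powR_ge0 ?ler0n ?ltW //.
apply: lt_le_trans (archi_boundP (powR_ge0 _ _)) _.
by rewrite ler_nat.
Qed.

Lemma eventually_all (I : finType) (P : I -> nat -> Prop) :
  (forall i, exists r0, forall r, (r0 <= r)%N -> P i r) ->
  exists r0, forall r, (r0 <= r)%N -> forall i, P i r.
Proof.
move=> /dep_choice[f Hf]; exists (\max_i f i)%N => r rf i; apply: Hf.
exact: leq_trans (leq_bigmax i) rf.
Qed.

(** All bad exponents lie below the largest good one, so finitely many bad terms lose for large r.
    The threshold is uniform in the coefficients [c] between [lo] and [hi]. *)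
Lemma dominance (I : finType) (V good : pred I) (E : I -> rat) (lo hi : R) :
  0 < lo -> (exists i, V i && good i) ->
  (forall i, V i -> ~~ good i -> exists j, [&& V j, good j & E i < E j]) ->
  exists r0, forall r, (r0 <= r)%N -> (0 < r)%N ->
    forall c : I -> R, (forall i, V i -> lo <= c i <= hi) ->
    0 < \sum_(i | V i) (-1) ^+ (~~ good i) * (c i * ratpow R r (E i)).
Proof.
move=> lo0 [i0 Vi0] dom.
have [j0 /andP[Vj0 gj0] jmax] : exists2 j0, V j0 && good j0 &
    forall j, V j && good j -> E j <= E j0.
  by case: (@Order.TotalTheory.arg_maxP _ _ _ i0 (fun i => V i && good i) E Vi0) => j ? ?; exists j.
have gap i : V i -> ~~ good i -> E i < E j0.
  move=> Vi gi; have [j /and3P[Vj gj Eij]] := dom i Vi gi.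
  by apply: lt_le_trans Eij (jmax _ _); rewrite Vj.
(* Once r to each gap exceeds K, a bad term is at most 1/(#|I|+1) of the guaranteed size M of the
   best good term, so all bad terms together stay below M. *)
pose K := hi * #|I|.+1%:R / lo.
have [r0 Hr0] : exists r0, forall r, (r0 <= r)%N -> forall i,
    V i -> ~~ good i -> K <= ratpow R r (E j0 - E i).
  apply: eventually_all => i.
  have [Vi|] := boolP (V i); last by exists 0%N.
  have [gi|gi] := boolP (good i); first by exists 0%N.
  have [r0 Hr0] : exists r0, forall r : nat, (r0 <= r)%N -> K <= ratpow R r (E j0 - E i).
    by apply: ratpow_large; rewrite subr_gt0 gap.
  by exists r0 => r rr _ _; exact: Hr0.
exists r0 => r rr rp c Hc.
have rE a : 0 < ratpow R r a by exact: ratpow_gt0.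
have I0 : 0 < #|I|.+1%:R :> R by rewrite ltr0n.
pose M := lo * ratpow R r (E j0).
have M0 : 0 < M by rewrite mulr_gt0.
have bad i : V i -> ~~ good i -> c i * ratpow R r (E i) <= M / #|I|.+1%:R.
  move=> Vi gi; rewrite ler_pdivlMr // /M.
  have -> : E j0 = (E j0 - E i) + E i by rewrite subrK.
  rewrite ratpowD // mulrA mulrAC ler_pM2r //.
  have := Hr0 r rr i Vi gi; rewrite /K ler_pdivrMr // [ratpow _ _ _ * lo]mulrC.
  apply: le_trans; rewrite ler_pM2r //.
  by have /andP[] := Hc i Vi.
rewrite (bigD1 j0) //= gj0 expr0 mul1r.
apply: (@lt_le_trans _ _ (M - \sum_(i | V i && (i != j0)) M / #|I|.+1%:R)).
  rewrite subr_gt0 sumr_const -[ltLHS]mulr_natr -[ltLHS]mulrA gtr_pMr // mulrC ltr_pdivrMr // mul1r.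
  by rewrite ltr_nat ltnS max_card.
rewrite -sumrN; apply: lerD; last first.
  apply: ler_sum => i /andP[Vi _].
  have [gi|gi] := boolP (good i).
    rewrite expr0 mul1r; apply: (@le_trans _ _ 0).
      by rewrite oppr_le0 divr_ge0 // ltW.
    have /andP[ci _] := Hc i Vi; rewrite mulr_ge0 ?(ltW (rE _)) //.
    exact: le_trans (ltW lo0) ci.
  by rewrite expr1 mulN1r lerN2 bad.
by rewrite /M ler_pM2r //; have /andP[] := Hc _ Vj0.
Qed.

End Dominance.

(** The degree bound M is common to all factors, so one finite index type, independent of the
    polynomials, describes the choices of degrees. *)
Lemma coef_prod_family (F : comNzRingType) k (p : 'I_k -> {poly F}) (q : {poly F}) M N n :
  (forall i, size (p i) <= M)%N -> (size q <= N)%N ->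
  ((\prod_i p i) * q)`_n =
  \sum_(c : {ffun 'I_k -> 'I_M} * 'I_N | (\sum_i c.1 i + c.2 == n)%N)
    (\prod_i (p i)`_(c.1 i)) * q`_(c.2).
Proof.
move=> sp sq.
have expand (s : {poly F}) K : (size s <= K)%N -> s = \sum_(l < K) s`_l *: 'X^l.
  by move=> sK; rewrite -poly_def; apply/polyP => l; rewrite coef_poly; case: ltnP => // Kl;
     rewrite nth_default // (leq_trans sK).
rewrite (eq_bigr (fun i => \sum_(l < M) (p i)`_l *: 'X^l)); last first.
  by move=> i _; apply: expand.
rewrite bigA_distr_bigA /= {1}(expand _ _ sq) big_distrlr /=.
rewrite pair_big /= coef_sum [in RHS]big_mkcond /=.
apply: eq_bigr => -[f l] _ /=.
rewrite scaler_prod prodrXr -scalerAl -scalerAr scalerA -exprD coefZ coefXn eq_sym.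
by case: eqP => _; rewrite ?mulr1 ?mulr0.
Qed.

(** * The choice of exponents and the sign of every coefficient *)

Section Exponents.
Variables (R : realType) (k : nat) (d : 'I_k -> nat).
Hypothesis d_ge2 : forall i, (2 <= d i)%N.

(** The quantity 3^-i for blocks numbered from 1, whence the shift of the index. *)
Definition gap (i : 'I_k) : rat := 3^-1 ^+ i.+1.
Definition small : rat := 3^-1 ^+ k / 4.

Definition alpha_of (i : 'I_k.+1) : rat :=
  if unlift ord0 i is Some j then 1 - gap j else 1 / 2.
Definition beta_of (i : 'I_k.+1) : rat :=
  if unlift ord0 i is Some j then gap j + 2 * small else 1 / 2 + small.

Lemma alpha_of_lift j : alpha_of (lift ord0 j) = 1 - gap j.
Proof. by rewrite /alpha_of liftK. Qed.
Lemma beta_of_lift j : beta_of (lift ord0 j) = gap j + 2 * small.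
Proof. by rewrite /beta_of liftK. Qed.
Lemma alpha_of0 : alpha_of ord0 = 1 / 2.
Proof. by rewrite /alpha_of unlift_none. Qed.
Lemma beta_of0 : beta_of ord0 = 1 / 2 + small.
Proof. by rewrite /beta_of unlift_none. Qed.

Lemma small_gt0 : 0 < small.
Proof. by rewrite divr_gt0 // exprn_gt0. Qed.

Lemma small_le_gap i : 4 * small <= gap i.
Proof.
rewrite /small /gap mulrC divfK //.
by apply: ler_wiXn2l => //; lra.
Qed.

Lemma gap_le i : gap i <= 1 / 3.
Proof.
rewrite /gap exprS -[leRHS]mulr1 mul1r ler_wpM2l //.
by apply: exprn_ile1 => //; lra.
Qed.

Lemma gap_dec (i p : 'I_k) : (i < p)%N -> 3 * gap p <= gap i.
Proof.
move=> ip; rewrite /gap exprS mulVKf //.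
by apply: ler_wiXn2l => //; lra.
Qed.

Lemma alpha_of_gt0 i : 0 < alpha_of i.
Proof.
rewrite /alpha_of; case: (unlift ord0 i) => [j|]; last by lra.
have := gap_le j; lra.
Qed.

Lemma beta_of_gt0 i : 0 < beta_of i.
Proof.
rewrite /beta_of; have s0 := small_gt0; case: (unlift ord0 i) => [j|]; last by lra.
have := small_le_gap j; lra.
Qed.

(** The exponent of r at t^l in $P_i$: l times alpha_i, plus beta_i in the top degree. *)
Definition block_exp (i : 'I_k) (l : nat) : rat :=
  l%:R * (1 - gap i) + (l == d i)%:R * (gap i + 2 * small).

Definition reeve_exp (l : nat) : rat := l%:R * (1 / 2) + (odd l)%:R * (1 / 2 + small).

Lemma block_expE i l : block_exp i l = l%:R + weight d gap small i l.
Proof. rewrite /block_exp /weight; ring. Qed.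

Lemma reeve_expE l : reeve_exp l = l%:R + weight0 small l.
Proof. by rewrite /reeve_exp /weight0; field. Qed.

Let D := (\sum_i d i)%N.
Let config := ({ffun 'I_k -> 'I_D.+1} * 'I_4)%type.

Definition config_exp (c : config) : rat :=
  \sum_i block_exp i (c.1 i) + reeve_exp c.2.

Definition config_valid (n : nat) (c : config) : bool :=
  (\sum_i c.1 i + c.2 == n)%N && [forall i, (c.1 i <= d i)%N].

(** Good means that the sign of the term, negative exactly for Reeve degree 1, is the sign claimed
    for the coefficient of t^n. *)
Definition config_good (n : nat) (c : config) : bool :=
  if positive_exponent d n then c.2 != 1%N :> nat else c.2 == 1%N :> nat.

Lemma config_expE n c : config_valid n c ->
  config_exp c = n%:R + (\sum_i weight d gap small i (c.1 i) + weight0 small c.2).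
Proof.
move=> /andP[/eqP <- _]; rewrite /config_exp reeve_expE.
rewrite [X in X + _ = _](eq_bigr _ (fun i _ => block_expE i (c.1 i))).
by rewrite big_split /= natrD natr_sum addrACA.
Qed.

Lemma exists_config n (l : 'I_k -> nat) (l0 : 'I_4) :
  (forall i, l i <= d i)%N -> (\sum_i l i + l0 = n)%N ->
  exists c : config, [/\ config_valid n c, c.2 = l0 & forall i, c.1 i = l i :> nat].
Proof.
move=> ld sl.
have E i : ([ffun i => inord (l i)] : {ffun 'I_k -> 'I_D.+1}) i = l i :> nat.
  rewrite ffunE inordK // ltnS (leq_trans (ld i)) // /D (bigD1 i) //= leq_addr //.
exists ([ffun i => inord (l i)], l0); split=> //.
rewrite /config_valid /=; apply/andP; split.
  by rewrite -sl; apply/eqP; congr addn; apply: eq_bigr => i _.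
by apply/forallP => i; rewrite E.
Qed.

Lemma exists_filling s : (s <= D)%N ->
  exists l : 'I_k -> nat, (forall i, l i <= d i)%N /\ (\sum_i l i = s)%N.
Proof.
elim: s => [|s IH] sD; first by exists (fun=> 0%N); split=> //; rewrite big1.
have [l [ld sl]] := IH (ltnW sD).
have [|l' [? E _]] := add_unit small_gt0 small_le_gap gap_le ld; first by rewrite sl.
by exists l'; rewrite E sl.
Qed.

(** At tail sums the filled tail with Reeve degree 0 wins. At 0, D+2 and D+3 no admissible choice
    has Reeve degree 1, since the blocks hold at most D units, so a single positive term suffices.
    All other n are at most D+1 and fall to [exchange]. *)
Lemma config_dominance n : (n <= D + 3)%N ->
  (exists c, config_valid n c && config_good n c) /\
  (forall c, config_valid n c -> ~~ config_good n c ->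
     exists c', [&& config_valid n c', config_good n c' & config_exp c < config_exp c']).
Proof.
move=> nD.
have full : (\sum_i d i = D)%N by [].
have bound (c : config) : config_valid n c -> (\sum_i c.1 i <= D)%N.
  by move=> /andP[_ /forallP H]; apply: leq_sum => i _; exact: H.
have [pos|neg] := boolP (positive_exponent d n); rewrite /config_good ?pos ?(negPf neg).
  have [/existsP[j /eqP nj]|notail] := boolP [exists j : 'I_k, n == (\sum_(i < k | (j <= i)%N) d i)%N].
    have [c [vc c0 cl]] := @exists_config n (tail_config d j) ord0
      (fun i => ltac:(by rewrite /tail_config; case: ifP)) ltac:(by rewrite addn0 nj [RHS]big_mkcond).
    split; first by exists c; rewrite vc c0.
    move=> c' vc' /negPn/eqP c'1; exists c; rewrite vc c0 /=.
    rewrite !(config_expE (n := n)) // ltrD2l c'1 c0.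
    rewrite [ltRHS](_ : _ = \sum_i weight d gap small i (tail_config d j i) + weight0 small 0);
      last by congr (_ + _); apply: eq_bigr => i _; rewrite cl.
    have /andP[/eqP s /forallP v] := vc'.
    apply: (tail_dominates d_ge2 small_gt0 small_le_gap gap_dec) => //.
    by rewrite /tailsum -nj -s c'1.
  have {pos} : [|| n == (D + 3)%N, n == (D + 2)%N | n == 0%N].
    by move: pos; rewrite /positive_exponent /= (negPf notail) orbF.
  case/or3P => /eqP nE.
  - have [c [vc c3 _]] := @exists_config n d (inord 3) (fun=> leqnn _) ltac:(by rewrite inordK // full).
    split; first by exists c; rewrite vc c3 inordK.
    move=> c' vc' /negPn/eqP c'1; have := bound _ vc'.
    by case/andP: vc' => /eqP; lia.
  - have [c [vc c2 _]] := @exists_config n d (inord 2) (fun=> leqnn _) ltac:(by rewrite inordK // full).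
    split; first by exists c; rewrite vc c2 inordK.
    move=> c' vc' /negPn/eqP c'1; have := bound _ vc'.
    by case/andP: vc' => /eqP; lia.
  - have [c [vc c0 _]] := @exists_config n (fun=> 0%N) ord0 (fun=> leq0n _) ltac:(by rewrite big1).
    split; first by exists c; rewrite vc c0.
    move=> c' vc' /negPn/eqP c'1.
    by case/andP: vc' => /eqP; lia.
move: neg; rewrite /positive_exponent /= -/D !negb_or => /and4P[n3 n2 n0 nt].
have notail j : n != tailsum d j by move: nt; rewrite negb_exists => /forallP /(_ j).
split.
  have [|l [ld sl]] := @exists_filling n.-1; first by lia.
  have [|c [vc c1 _]] := @exists_config n l (inord 1) ld; first by rewrite inordK // sl; lia.
  by exists c; rewrite vc c1 inordK.
move=> c vc c1; have /andP[/eqP s /forallP v] := vc.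
have [|l [ld sl lt]] := exchange d_ge2 small_gt0 small_le_gap gap_le gap_dec v (ltn_ord c.2) s _ notail c1.
  by rewrite -/D lt0n n0 /=; lia.
have [|c' [vc' c'1 cl]] := @exists_config n l (inord 1) ld; first by rewrite inordK.
exists c'; rewrite vc' c'1 inordK //=.
rewrite !(config_expE (n := n)) // ltrD2l c'1 inordK //.
rewrite [ltRHS](_ : _ = \sum_i weight d gap small i (l i) + weight0 small 1) //.
by congr (_ + _); apply: eq_bigr => i _; rewrite cl.
Qed.

(** Only the exponents of r and bounds on the remaining factors enter, so the same statement applies
    to $P$ and to the Ehrhart polynomial. *)
Lemma coef_signs (lo hi : R) : 0 < lo ->
  exists r0, forall r, (r0 <= r)%N -> (0 < r)%N ->
  forall (p : 'I_k -> {poly R}) (q : {poly R}),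
    (forall i, size (p i) <= (d i).+1)%N -> (size q <= 4)%N ->
    (forall i l, (l <= d i)%N ->
       exists2 c, lo <= c <= hi & (p i)`_l = c * ratpow R r (block_exp i l)) ->
    (forall l, (l < 4)%N ->
       exists2 c, lo <= c <= hi & q`_l = (-1) ^+ (l == 1)%N * (c * ratpow R r (reeve_exp l))) ->
  forall n, (n <= D + 3)%N ->
    if positive_exponent d n then 0 < ((\prod_i p i) * q)`_n
    else ((\prod_i p i) * q)`_n < 0.
Proof.
move=> lo0.
have [r0 Hr0] : exists r0, forall r, (r0 <= r)%N -> forall n : 'I_(D + 4), (0 < r)%N ->
    forall c : config -> R, (forall i, config_valid n i -> lo ^+ k * lo <= c i <= hi ^+ k * hi) ->
    0 < \sum_(i | config_valid n i)
      (-1) ^+ (~~ config_good n i) * (c i * ratpow R r (config_exp i)).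
  apply: eventually_all => n.
  have [|ex dom] := @config_dominance n; first by have := ltn_ord n; lia.
  have [|r0 Hr0] := @dominance R _ _ _ config_exp (lo ^+ k * lo) (hi ^+ k * hi) _ ex dom.
    by rewrite mulr_gt0 // exprn_gt0.
  by exists r0 => r rr r1 c Hc; apply: Hr0.
exists r0 => r rr r1 p q sp sq Hp Hq n nD.
have /dep_choice[cp Hcp] : forall i, exists c : nat -> R, forall l, (l <= d i)%N ->
    lo <= c l <= hi /\ (p i)`_l = c l * ratpow R r (block_exp i l).
  move=> i; apply: (@dep_choice _ (fun=> R)
    (fun l c => (l <= d i)%N -> lo <= c <= hi /\ (p i)`_l = c * ratpow R r (block_exp i l))) => l.
  by case: (leqP l (d i)) => [/Hp[c ? ?]|_]; [exists c|exists 0].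
have [cq Hcq] : exists c : nat -> R, forall l, (l < 4)%N ->
    lo <= c l <= hi /\ q`_l = (-1) ^+ (l == 1)%N * (c l * ratpow R r (reeve_exp l)).
  apply: (@dep_choice _ (fun=> R)
    (fun l c => (l < 4)%N -> lo <= c <= hi /\ q`_l = (-1) ^+ (l == 1)%N * (c * ratpow R r (reeve_exp l)))) => l.
  by case: (ltnP l 4) => [/Hq[c ? ?]|_]; [exists c|exists 0].
pose C (c : config) := (\prod_i cp i (c.1 i)) * cq c.2.
have hC i : config_valid n i -> lo ^+ k * lo <= C i <= hi ^+ k * hi.
  move=> /andP[_ /forallP v]; have [/andP[q1 q2] _] := Hcq _ (ltn_ord i.2).
  have b j : lo <= cp j (i.1 j) <= hi by have [] := Hcp j _ (v j).
  have lok : lo ^+ k = \prod_(j < k) lo by rewrite prodr_const card_ord.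
  have hik : hi ^+ k = \prod_(j < k) hi by rewrite prodr_const card_ord.
  have l0 : 0 <= lo by exact: ltW.
  apply/andP; split; apply: ler_pM => //.
  - by rewrite exprn_ge0.
  - by rewrite lok ler_prod // => j _; rewrite l0; have /andP[] := b j.
  - by apply: prodr_ge0 => j _; apply: le_trans l0 _; have /andP[] := b j.
  - exact: le_trans l0 q1.
  - rewrite hik ler_prod // => j _; have /andP[b1 ->] := b j.
    by rewrite (le_trans l0 b1).
have coefE : ((\prod_i p i) * q)`_n = \sum_(c | config_valid n c)
    (-1) ^+ (c.2 == 1%N :> nat) * (C c * ratpow R r (config_exp c)).
  rewrite (@coef_prod_family _ _ _ _ D.+1 4) //; last first.
    move=> i; rewrite (leq_trans (sp i)) // ltnS /D (bigD1 i) //= leq_addr //.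
  (* Choices in which some degree exceeds d_i contribute zero; the valid ones remain. *)
  rewrite (bigID (fun c : config => [forall i, (c.1 i <= d i)%N])) /= [X in _ + X]big1 ?addr0.
    apply: eq_bigr => c /andP[_ /forallP v].
    have [_ ->] := Hcq _ (ltn_ord c.2).
    rewrite /C (ratpowD R (\sum_i block_exp i (c.1 i)) _ r1) (ratpow_sum R _ r1).
    rewrite (eq_bigr (fun i => cp i (c.1 i) * ratpow R r (block_exp i (c.1 i)))); last first.
      by move=> i _; have [_ ->] := Hcp i _ (v i).
    by rewrite big_split /=; ring.
  move=> c /andP[_]; rewrite negb_forall => /existsP[i].
  rewrite -ltnNge => ci; rewrite (bigD1 i) //= nth_default ?mul0r //.
  by rewrite (leq_trans (sp i)).
have n4 : (n < D + 4)%N by lia.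
have := Hr0 r rr (Ordinal n4) r1 C hC; rewrite coefE /config_good /=.
case: ifP => _ H.
  by move: H; under eq_bigr do rewrite negbK.
rewrite -oppr_gt0 -sumrN; move: H; congr (0 < _).
by apply: eq_bigr => c _; case: eqP => _ /=; rewrite ?expr0 ?expr1; ring.
Qed.

End Exponents.

(** * The sign pattern as a list *)

Definition tailsums (ds : seq nat) : seq nat :=
  [seq sumn (drop j ds) | j <- iota 0 (size ds)].

Lemma tailsums_cons e ds : tailsums (e :: ds) = (e + sumn ds)%N :: tailsums ds.
Proof. by rewrite /tailsums /= -add1n iotaDl -map_comp. Qed.

Lemma tailsums_le ds n : n \in tailsums ds -> (n <= sumn ds)%N.
Proof.
move=> /mapP[j _ ->]; rewrite -{2}(cat_take_drop j ds) sumn_cat.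
exact: leq_addl.
Qed.

(** Read in descending order, the exponents of the first block run from its tail sum down to just
    above the next one, so only the first of them is a tail sum. *)
Lemma flatten_sign_blocks (ds : seq nat) : all (leq 1) ds ->
  flatten [seq 1 :: nseq e.-1 (-1) | e <- ds] =
  [seq if n \in tailsums ds then 1 else -1 | n <- rev (iota 1 (sumn ds))] :> seq int.
Proof.
elim: ds => [//|[//|e] ds IH] /andP[_ ads]; rewrite [LHS]/= {}IH // tailsums_cons.
have -> : (sumn (e.+1 :: ds) = sumn ds + e + 1)%N by rewrite /=; lia.
rewrite !iotaD !rev_cat !map_cat /= inE -(addn1 e).
have -> : (1 + (sumn ds + e) == e + 1 + sumn ds)%N by lia.
congr (_ :: _ ++ _).
  set s := map _ _; have sz : size s = e by rewrite size_map size_rev size_iota.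
  rewrite -[in LHS]sz; apply/esym/all_pred1P; apply/allP => y /mapP[n].
  rewrite mem_rev mem_iota => /andP[n1 n2] ->.
  case: ifP => //; rewrite inE => /orP[/eqP|/tailsums_le]; lia.
apply/eq_in_map => n; rewrite mem_rev mem_iota => /andP[n1 n2].
by rewrite inE; case: eqP => //; lia.
Qed.

Section SignPattern.
Variables (k : nat) (d : 'I_k -> nat).
Hypothesis d_ge2 : forall i, (2 <= d i)%N.

Let ds := [seq d i | i <- enum 'I_k].

Lemma sumn_drop_enum j : sumn (drop j ds) = (\sum_(i < k | (j <= i)%N) d i)%N.
Proof.
have sz : size ds = k by rewrite size_map size_enum_ord.
have nthds (i : 'I_k) : nth 0%N ds i = d i.
  by rewrite (nth_map i) ?size_enum_ord // nth_ord_enum.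
transitivity (\sum_(j <= i < k) nth 0%N ds i)%N.
  rewrite sumnE (big_nth 0%N) size_drop sz -[in RHS](add0n j) big_addn.
  by apply: eq_bigr => i _; rewrite nth_drop addnC.
by rewrite big_geq_mkord; apply: eq_bigr => i _.
Qed.

Lemma sumn_ds : sumn ds = (\sum_i d i)%N.
Proof. by rewrite -[ds]drop0 sumn_drop_enum. Qed.

Lemma mem_tailsums n :
  (n \in tailsums ds) = [exists j : 'I_k, n == (\sum_(i < k | (j <= i)%N) d i)%N].
Proof.
have sz : size ds = k by rewrite size_map size_enum_ord.
apply/mapP/existsP => [[j]|[j /eqP ->]].
  rewrite mem_iota sz => /andP[_ jk] ->; exists (Ordinal jk).
  by rewrite sumn_drop_enum.
by exists (j : nat); rewrite ?sumn_drop_enum // mem_iota sz ltn_ord.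
Qed.

Lemma positive_exponent_mid n : (1 <= n <= \sum_i d i)%N ->
  positive_exponent d n = (n \in tailsums ds).
Proof.
move=> nD; rewrite mem_tailsums /positive_exponent /=.
set D := (\sum_i d i)%N in nD *.
have -> : (n == D + 3)%N = false by lia.
have -> : (n == D + 2)%N = false by lia.
by have -> : (n == 0)%N = false by lia.
Qed.

Lemma positive_exponent_succ : positive_exponent d (\sum_i d i).+1 = false.
Proof.
rewrite /positive_exponent /= -mem_tailsums -sumn_ds.
set D := sumn ds.
have -> : (D.+1 == D + 3)%N = false by lia.
have -> : (D.+1 == D + 2)%N = false by lia.
by apply/negbTE/negP => /tailsums_le; rewrite -/D ltnn.
Qed.

(** The exponents run from D+1 down to 1: D+1 gives the leading -1 and the other D exponents give
    the blocks. *)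
Lemma sign_patternE :
  [seq if positive_exponent d n then 1 else -1
     | n <- rev (iota 1 (\sum_i d i + 3 - 2))] = sign_pattern d.
Proof.
have -> : (\sum_i d i + 3 - 2 = \sum_i d i + 1)%N by lia.
rewrite iotaD rev_cat map_cat /= add1n positive_exponent_succ /sign_pattern.
congr (_ :: _).
have -> : [seq 1 :: nseq (d i).-1 (-1) | i <- enum 'I_k] =
          [seq 1 :: nseq e.-1 (-1) | e <- ds] :> seq (seq int).
  by rewrite /ds -map_comp.
rewrite flatten_sign_blocks; last first.
  by apply/allP => _ /mapP[i _ ->]; exact: ltnW.
rewrite sumn_ds; apply/eq_in_map => n; rewrite mem_rev mem_iota => nD.
by rewrite positive_exponent_mid //; lia.
Qed.

End SignPattern.

(** * Integrality of the powers of r and coefficients of the factors *)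

Section Assembly.
Variable R : realType.

(** The power is s raised to L a, which is a natural exponent because the denominator of a divides
    L. *)
Lemma ratpow_perfect_power (L s : nat) (a : rat) : 0 < a -> (0 < s)%N ->
  (`|denq a| %| L)%N -> positive_integer (ratpow R (s ^ L) a).
Proof.
move=> a0 s0 /dvdnP[q ->].
exists (s ^ (q * `|numq a|))%N; first by rewrite expn_gt0 s0.
have E : (q * `|denq a|)%N%:R * ratr a = (q * `|numq a|)%N%:R :> R.
  rewrite -[LHS](_ : ratr ((q * `|denq a|)%N%:R * a) = _); last first.
    by rewrite rmorphM /= ratr_nat.
  rewrite -[RHS]ratr_nat; congr ratr.
  rewrite !natrM -mulrA; congr (_ * _).
  have n0 : 0 < numq a by rewrite numq_gt0.
  rewrite !pmulrn.
  by rewrite !gez0_abs ?ltW ?denq_gt0 // numqE mulrC.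
by rewrite /ratpow natrX -powR_mulrn ?ler0n // -powRrM E powR_mulrn ?ler0n // natrX.
Qed.

Lemma dvdn_lcm_denoms k (alpha beta : 'I_k.+1 -> rat) i :
  (`|denq (alpha i)| %| lcm_denoms alpha beta)%N /\
  (`|denq (beta i)| %| lcm_denoms alpha beta)%N.
Proof.
rewrite /lcm_denoms (bigD1 i) //=; split; apply: dvdn_trans (dvdn_lcml _ _).
  exact: dvdn_lcml.
exact: dvdn_lcmr.
Qed.

Lemma perfect_power_pos L r : (0 < r)%N -> perfect_power L r ->
  exists2 s, (0 < s)%N & r = (s ^ L)%N.
Proof.
move=> r0 [[|s] rE]; last by exists s.+1.
(* Base 0 gives a positive r only as 0^0 = 1, where base 1 does as well. *)
case: L rE => [|L] rE; first by exists 1%N; rewrite ?rE.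
by move: r0; rewrite rE exp0n.
Qed.

Lemma size_poly_coef (p : {poly R}) n :
  (forall j, (n < j)%N -> p`_j = 0) -> p`_n != 0 -> size p = n.+1.
Proof.
move=> p0 pn; apply/eqP; rewrite eqn_leq; apply/andP; split.
  by apply/leq_sizeP => j; exact: p0.
by rewrite ltnNge; apply: contra pn => sz; rewrite nth_default.
Qed.

Lemma coef_monomial_sum (d : nat) (c : R) (f : nat -> R) l :
  (c *: 'X^d + \sum_(l < d) f l *: 'X^l)`_l =
  if l == d then c else if (l < d)%N then f l else 0.
Proof.
rewrite -(poly_def d f) coefD coefZ coefXn coef_poly.
by case: eqP => [->|_]; rewrite ?ltnn ?mulr1 ?addr0 // mulr0 add0r.
Qed.

Lemma coef_comp_scale (p : {poly R}) c l : (p \Po (c *: 'X))`_l = p`_l * c ^+ l.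
Proof.
rewrite comp_polyE coef_sum.
under eq_bigr do rewrite exprZn coefZ coefZ coefXn.
case: (ltnP l (size p)) => lp.
  rewrite (bigD1 (Ordinal lp)) //= eqxx mulr1 big1 ?addr0 // => i il.
  by rewrite [l == i]eq_sym -[nat_of_ord i == l]/(i == Ordinal lp) (negPf il) !mulr0.
rewrite nth_default // mul0r big1 // => i _.
by rewrite gtn_eqF ?(leq_trans _ lp) // !mulr0.
Qed.

Lemma size_comp_scale_le (p : {poly R}) c n :
  (size p <= n)%N -> (size (p \Po (c *: 'X)) <= n)%N.
Proof.
move=> sp; apply/leq_sizeP => j nj.
by rewrite coef_comp_scale nth_default ?mul0r // (leq_trans sp).
Qed.

Lemma coef_factor0 r a b l : (factor0 R r a b)`_l =
  if l is 0 then 1 else if l is 1 then - ratpow R r (a + b) else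
  if l is 2 then ratpow R r (2 * a) else if l is 3 then ratpow R r (b + 3 * a) else 0.
Proof.
rewrite /factor0 !coefE.
by case: l => [|[|[|[|l]]]] /=; rewrite ?(mulr0, mulr1, addr0, add0r, subr0, oppr0).
Qed.

Lemma coef_reeve_poly m l : (reeve_poly R m)`_l =
  if l is 0 then 1 else if l is 1 then 2 - m%:R / 6 else
  if l is 2 then 1 else if l is 3 then m%:R / 6 else 0.
Proof.
rewrite /reeve_poly !coefE.
by case: l => [|[|[|[|l]]]] /=; rewrite ?(mulr0, mulr1, addr0, add0r, subr0, oppr0).
Qed.

End Assembly.

(** * Signs of the product polynomial and of the Ehrhart polynomial *)

Section Main.
Variables (R : realType) (k : nat) (d : 'I_k -> nat).
Hypothesis d_ge2 : forall i, (2 <= d i)%N.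
Local Notation alpha := (@alpha_of k).
Local Notation beta := (@beta_of k).
Let D := (\sum_i d i)%N.

Lemma size_prod_poly r : (0 < r)%N -> size (prod_poly R d alpha beta r) = (D + 3).+1.
Proof.
move=> r0.
have s0 : size (factor0 R r (alpha ord0) (beta ord0)) = 4%N.
  apply: size_poly_coef => [[|[|[|[|j]]]] // _|]; rewrite coef_factor0 //.
  by rewrite gt_eqF // ratpow_gt0.
have si i : size (factori R r (d i) (alpha (lift ord0 i)) (beta (lift ord0 i))) = (d i).+1.
  apply: size_poly_coef => [j dj|]; rewrite /factori
    (@coef_monomial_sum _ _ _ (fun l => ratpow R r (l%:R * alpha (lift ord0 i)))).
    by rewrite gtn_eqF // ltnNge ltnW.
  by rewrite eqxx gt_eqF // ratpow_gt0.
have nzi i : factori R r (d i) (alpha (lift ord0 i)) (beta (lift ord0 i)) != 0.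
  by rewrite -size_poly_eq0 si.
rewrite /prod_poly size_mul.
- rewrite size_prod // s0.
  under eq_bigr do rewrite si.
  rewrite cardT size_enum_ord; under eq_bigr do rewrite -addn1.
  by rewrite big_split /= sum1_card card_ord -/D; lia.
- by apply/prodf_neq0 => i _.
- by rewrite -size_poly_eq0 s0.
Qed.

Lemma prod_polytope_factor r (c m : 'I_k.+1 -> nat) :
  (forall i, (0 < c i)%N /\ (0 < m i)%N) ->
  (forall i, ratpow R r (alpha i) = (c i)%:R /\ ratpow R r (beta i) = (m i)%:R) ->
  ehrhart_factor (prod_polytope R d alpha beta r)
    ((\prod_i (simplex_poly R (d i) (m (lift ord0 i)) \Po ((c (lift ord0 i))%:R *: 'X)))
     * (reeve_poly R (m ord0) \Po ((c ord0)%:R *: 'X))).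
Proof.
move=> cm0 E; rewrite /prod_polytope; apply: factor_prod2.
  apply: (@factor_prodn R k d (fun i : 'I_k =>
       dilate (ratpow R r (alpha (lift ord0 i)))
         (Ssimplex (d := d i) (ratpow R r (beta (lift ord0 i)))))) => i.
  have [-> ->] := E (lift ord0 i); have [c0 m0] := cm0 (lift ord0 i).
  by apply: factor_dilate => //; apply: factor_Ssimplex.
have [-> ->] := E ord0; have [c0 m0] := cm0 ord0.
by apply: factor_dilate => //; apply: factor_reeve.
Qed.

Lemma ratpow_block_exp r i l : (0 < r)%N ->
  ratpow R r (block_exp d i l) = ratpow R r (alpha (lift ord0 i)) ^+ l *
    (if l == d i then ratpow R r (beta (lift ord0 i)) else 1).
Proof.
move=> r0; rewrite /block_exp ratpowD // !ratpowMn // alpha_of_lift beta_of_lift.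
by case: eqP => _.
Qed.

Lemma ratpow_reeve_exp r l : (0 < r)%N ->
  ratpow R r (reeve_exp k l) = ratpow R r (alpha ord0) ^+ l *
    (if odd l then ratpow R r (beta ord0) else 1).
Proof.
move=> r0; rewrite /reeve_exp ratpowD // !ratpowMn // alpha_of0 beta_of0.
by case: odd.
Qed.

(** Common bounds for the factors beside the powers of r: these are 1, binomial coefficients (at
    most 2^D), 1/6, and 1/6 - 2/m_0, which is at least 1/12 once m_0 >= 24. *)
Let lo : R := 1 / 12.
Let hi : R := 2 ^+ D.

Lemma bin_bounds i l : (l <= d i)%N -> lo <= 'C(d i, l)%:R <= hi.
Proof.
move=> ld; apply/andP; split.
  have : (1 : R) <= 'C(d i, l)%:R by rewrite ler1n bin_gt0.
  rewrite /lo; lra.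
have h : ('C(d i, l) <= 2 ^ d i)%N.
  rewrite -[2%N]/(1 + 1)%N expnDn.
  under eq_bigr do rewrite !exp1n !muln1.
  rewrite (bigD1 (Ordinal (ld : (l < (d i).+1)%N))) //= leq_addr //.
apply: (@le_trans _ _ (2 ^ d i)%:R); first by rewrite ler_nat.
rewrite natrX /hi; apply: ler_weXn2l; first by lra.
by rewrite /D (bigD1 i) //= leq_addr.
Qed.

Lemma one_bounds : lo <= 1 <= hi.
Proof. by rewrite /lo /hi exprn_ege1 ?andbT; lra. Qed.

Lemma signs_eventually : exists r0, forall r, (r0 <= r)%N -> (0 < r)%N ->
  (forall n, (n <= D + 3)%N ->
     if positive_exponent d n then 0 < (prod_poly R d alpha beta r)`_n
     else (prod_poly R d alpha beta r)`_n < 0) /\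
  (forall c m : 'I_k.+1 -> nat,
     (forall i, ratpow R r (alpha i) = (c i)%:R /\ ratpow R r (beta i) = (m i)%:R) ->
   forall n, (n <= D + 3)%N ->
   let P := (\prod_i (simplex_poly R (d i) (m (lift ord0 i)) \Po ((c (lift ord0 i))%:R *: 'X)))
     * (reeve_poly R (m ord0) \Po ((c ord0)%:R *: 'X)) in
     if positive_exponent d n then 0 < P`_n else P`_n < 0).
Proof.
have lo0 : 0 < lo by rewrite /lo; lra.
have [r1 Hr1] := coef_signs d_ge2 hi lo0.
have [r2 Hr2] := ratpow_large (24 : R) (beta_of_gt0 (ord0 : 'I_k.+1)).
exists (maxn r1 r2) => r; rewrite geq_max => /andP[/Hr1{}Hr1 /Hr2{}Hr2] r0.
have [lo1 hi1] := andP one_bounds.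
split.
  apply: Hr1 => // [i||i l ld|l l4].
  - apply/leq_sizeP => j dj; rewrite /factori
      (@coef_monomial_sum _ _ _ (fun l => ratpow R r (l%:R * alpha (lift ord0 i)))).
    by rewrite gtn_eqF // ltnNge ltnW.
  - by apply/leq_sizeP => -[|[|[|[|j]]]] // _; rewrite coef_factor0.
  - exists 1; first exact: one_bounds.
    rewrite /factori
      (@coef_monomial_sum _ _ _ (fun l => ratpow R r (l%:R * alpha (lift ord0 i)))).
    rewrite mul1r ratpow_block_exp // leq_eqVlt in ld *; case: eqP ld => [->|_] /=.
      by rewrite ratpowD // ratpowMn // mulrC.
    by move=> ->; rewrite ratpowMn // mulr1.
  - exists 1; first exact: one_bounds.
    rewrite coef_factor0 mul1r ratpow_reeve_exp //.
    case: l l4 => [|[|[|[|//]]]] _ /=.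
    + by rewrite expr0 !mulr1.
    + by rewrite !expr1 mulN1r ratpowD.
    + by rewrite ratpowMn // mulr1 mul1r.
    + by rewrite ratpowD // ratpowMn // mul1r mulrC.
move=> c m E n nD /=; apply: Hr1 => // [i||i l ld|l l4].
- apply: size_comp_scale_le; apply/leq_sizeP => j dj.
  rewrite /simplex_poly (@coef_monomial_sum _ _ _ (fun l => 'C(d i, l)%:R)).
  by rewrite gtn_eqF // ltnNge ltnW.
- apply: size_comp_scale_le; apply/leq_sizeP => -[|[|[|[|j]]]] // _.
  by rewrite coef_reeve_poly.
- rewrite coef_comp_scale /simplex_poly (@coef_monomial_sum _ _ _ (fun l => 'C(d i, l)%:R)).
  rewrite ratpow_block_exp //; have [-> ->] := E (lift ord0 i).
  case: eqP => [->|/eqP nl].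
    by exists 1; [exact: one_bounds|rewrite mul1r mulrC].
  have -> : (l < d i)%N by rewrite ltn_neqAle nl.
  by exists 'C(d i, l)%:R; [exact: bin_bounds|rewrite mulr1].
- rewrite coef_comp_scale coef_reeve_poly ratpow_reeve_exp //.
  have [-> mE] := E ord0; move: Hr2; rewrite mE => m24.
  have m0 : (m ord0)%:R != 0 :> R by rewrite gt_eqF //; lra.
  case: l l4 => [|[|[|[|//]]]] _ /=.
  + by exists 1; rewrite ?one_bounds // expr0 !mulr1.
  (* The linear Reeve coefficient 2 - m_0/6 equals -(1/6 - 2/m_0) m_0, so it follows the exponent of
     m_0 with a negative sign. *)
  + exists (1 / 6 - 2 / (m ord0)%:R); last by rewrite !expr1; field.
    have h1 : 2 / (m ord0)%:R <= 1 / 12 :> R.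
      by rewrite ler_pdivrMr; lra.
    have h2 : 0 <= 2 / (m ord0)%:R :> R by rewrite divr_ge0; lra.
    by apply/andP; split; [rewrite /lo|apply: le_trans hi1]; lra.
  + by exists 1; rewrite ?one_bounds // expr0 !mul1r mulr1.
  + exists (1 / 6); last by rewrite expr0; field.
    by apply/andP; split; [rewrite /lo|apply: le_trans hi1]; lra.
Qed.

End Main.

Theorem theorem2p2 (R : realType) (k : nat) (hk : (1 <= k)%N)
    (d : 'I_k -> nat) (hd : forall i, (2 <= d i)%N) :
  exists alpha beta : 'I_k.+1 -> rat,
    [/\ forall i, 0 < alpha i,
        forall i, 0 < beta i,
        forall r : nat, (0 < r)%N ->
          perfect_power (lcm_denoms alpha beta) r ->
          [/\ forall i, positive_integer (ratpow R r (alpha i)) /\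
                        positive_integer (ratpow R r (beta i)),
              size (prod_poly R d alpha beta r) = ((\sum_i d i) + 3).+1%N,
              integral_polytope (prod_polytope R d alpha beta r)
            & has_dim (prod_polytope R d alpha beta r) (\sum_i d i + 3)%N]
      & exists r0 : nat, forall r : nat, (r0 <= r)%N -> (0 < r)%N ->
          perfect_power (lcm_denoms alpha beta) r ->
          Sgn (prod_polytope R d alpha beta r) = sign_pattern d /\
          (forall n : nat, (n <= \sum_i d i + 3)%N ->
             if positive_exponent d n
             then 0 < (prod_poly R d alpha beta r)`_n
             else (prod_poly R d alpha beta r)`_n < 0)].
Proof.
pose alpha := @alpha_of k; pose beta := @beta_of k.
have integers r : (0 < r)%N -> perfect_power (lcm_denoms alpha beta) r ->
    forall i, positive_integer (ratpow R r (alpha i)) /\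
              positive_integer (ratpow R r (beta i)).
  move=> r0 /(perfect_power_pos r0)[s s0 ->] i.
  have [da db] := dvdn_lcm_denoms alpha beta i.
  split; apply: ratpow_perfect_power => //; [exact: alpha_of_gt0|exact: beta_of_gt0].
(* The powers of r are replaced by the natural numbers they equal, since the Ehrhart polynomials are
   known for integral parameters. *)
have factor r : (0 < r)%N -> perfect_power (lcm_denoms alpha beta) r ->
    exists c m : 'I_k.+1 -> nat,
    (forall i, ratpow R r (alpha i) = (c i)%:R /\ ratpow R r (beta i) = (m i)%:R) /\
    ehrhart_factor (prod_polytope R d alpha beta r)
      ((\prod_i (simplex_poly R (d i) (m (lift ord0 i)) \Po ((c (lift ord0 i))%:R *: 'X)))
       * (reeve_poly R (m ord0) \Po ((c ord0)%:R *: 'X))).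
  move=> r0 /(integers r r0) H.
  have /dep_choice[c Hc] : forall i, exists c, (0 < c)%N /\ ratpow R r (alpha i) = c%:R.
    by move=> i; have [[N ? ?] _] := H i; exists N.
  have /dep_choice[m Hm] : forall i, exists m, (0 < m)%N /\ ratpow R r (beta i) = m%:R.
    by move=> i; have [_ [N ? ?]] := H i; exists N.
  have E i : ratpow R r (alpha i) = (c i)%:R /\ ratpow R r (beta i) = (m i)%:R.
    by have [_ ->] := Hc i; have [_ ->] := Hm i.
  exists c, m; split=> //; apply: prod_polytope_factor => // i.
  by have [? _] := Hc i; have [? _] := Hm i.
exists alpha, beta; split.
- exact: alpha_of_gt0.
- exact: beta_of_gt0.
- move=> r r0 pr; have [c [m [_ F]]] := factor r r0 pr; split.
  + exact: integers.
  + exact: size_prod_poly.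
  + exact: factor_integral F.
  + exact: factor_dim F.
- have [r0 Hr0] := signs_eventually R hd.
  exists r0 => r rr rp pr; have [signs ehr] := Hr0 r rr rp; split=> //.
  have [c [m [E F]]] := factor r rp pr.
  rewrite /Sgn (factor_ehrhart F) -sign_patternE //; apply/eq_in_map => n.
  rewrite mem_rev mem_iota add1n ltnS => /andP[_ /leq_trans/(_ (leq_subr _ _)) nD].
  have := ehr c m E n nD; case: ifP => _ /=; first exact: gtr0_sgz.
  exact: ltr0_sgz.
Qed.
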